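(* Let $\nu$ be an admissible profile with $\alpha_{\min}:=\inf\{\alpha:\nu(\alpha)\ge0\}\in\mathbb{R}$, let $\nu'$ be its dual profile, and for $\varepsilon>0$ let $\nu'_\varepsilon(\alpha'):=\nu'(\alpha'-\varepsilon)$. Then the topological dual of $S^\nu$ is $$(S^\nu)'=\bigcup_{\varepsilon>0}S^{\nu'_\varepsilon},$$ where $(S^\nu)'$ is identified with a space of sequences by associating to $u\in(S^\nu)'$ the sequence $y=\big(\overline{u(e^{j,k})}\big)_{(j,k)\in\Lambda}$, so that $u(x)=\langle x,y\rangle=\sum_{(j,k)\in\Lambda}x_{j,k}\overline{y_{j,k}}$ for all $x\in S^\nu$. (That is, $u\mapsto y$ is a bijection of $(S^\nu)'$ onto $\bigcup_{\varepsilon>0}S^{\nu'_\varepsilon}$ with inverse $y\mapsto\langle\cdot,y\rangle$.)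
   Context: Let $\mathbb{N}_0=\{0,1,2,\dots\}$, $\Lambda=\bigcup_{j\in\mathbb{N}_0}\{j\}\times\{0,\dots,2^j-1\}$ and $\Omega=\mathbb{C}^\Lambda$. For $(j,k)\in\Lambda$, $e^{j,k}\in\Omega$ is the sequence whose only non-zero component is $e^{j,k}_{j,k}=1$; it is known that for all $x\in S^\nu$ the sum $\sum_{(j,k)\in\Lambda}x_{j,k}e^{j,k}$ converges to $x$ in $S^\nu$. An admissible profile is a non-decreasing right-continuous function $\nu:\mathbb{R}\to\{-\infty\}\cup[0,1]$ that is not identically $-\infty$. The asymptotic profile of $x\in\Omega$ is $\nu_x(\alpha)=\lim_{\varepsilon\to0^+}\limsup_{j\to\infty}\frac{\log \#\{k:|x_{j,k}|\ge 2^{-(\alpha+\varepsilon)j}\}}{\log(2^j)}$ (with $\log 0=-\infty$), and $S^\nu=\{x\in\Omega:\nu_x(\alpha)\le\nu(\alpha)\ \forall\alpha\in\mathbb{R}\}$, which is a vector space. For $\alpha\in\mathbb{R}$ and $\beta\in\{-\infty\}\cup[0,+\infty)$ let $d_{\alpha,\beta}(x,y)=d_{\alpha,\beta}(x-y)$ with $d_{\alpha,\beta}(x)=\inf\{C\ge0:\ \forall j\in\mathbb{N}_0,\ \#\{k:|x_{j,k}|\ge C2^{-\alpha j}\}\le C2^{\beta j}\}$ (with $2^{\beta j}:=0$ if $\beta=-\infty$), and let $E(\alpha,\beta)=\{x\in\Omega:d_{\alpha,\beta}(x)<\infty\}$ with the metric $d_{\alpha,\beta}$. For any sequence $(\alpha_n)$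 dense in $\mathbb{R}$ and any sequence $\varepsilon_m\searrow0$ of positive reals, $S^\nu=\bigcap_{n,m}E(\alpha_n,\nu(\alpha_n)+\varepsilon_m)$, and the topology of $S^\nu$ is the coarsest topology making all inclusions $S^\nu\subset E(\alpha_n,\nu(\alpha_n)+\varepsilon_m)$ continuous. It is known that this topology does not depend on the choice of these sequences and makes $S^\nu$ a complete metrizable topological vector space. $(S^\nu)'$ is the space of continuous linear forms on $S^\nu$. Dual profile: put $[\![\beta]\!]=-\infty$ if $\beta<0$, $[\![\beta]\!]=\beta$ if $0\le\beta\le1$, $[\![\beta]\!]=1$ if $\beta\ge1$ (including $\beta=+\infty$). The dual profile of $\nu$ is the function $\nu':\alpha'\mapsto[\![\alpha'+\inf\{\alpha:\nu(\alpha)-\alpha>\alpha'\}]\!]$, with $\inf\emptyset=+\infty$. It is an admissible profile, as are the $\nu'_\varepsilon$, so $S^{\nu'_\varepsilon}$ is defined in the same way as $S^\nu$. *)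

(* Defs.v *)
From HB Require Import structures.
From mathcomp Require Import all_boot all_order all_algebra finmap.
From mathcomp Require Import complex.
From mathcomp Require Import all_classical all_reals all_analysis.
From mathcomp Require Import lra ring.
From mathcomp.analysis.showcase Require summability.

Set Implicit Arguments.
Unset Strict Implicit.
Unset Printing Implicit Defensive.

Import Order.TTheory GRing.Theory Num.Theory.
Import numFieldNormedType.Exports.
Import ComplexField.Normc.

Local Open Scope classical_set_scope.
Local Open Scope ring_scope.
Local Open Scope complex_scope.

Definition Lambda : choiceType := {j : nat & 'I_(2 ^ j)}.

Definition idx (j : nat) (k : 'I_(2 ^ j)) : Lambda := Tagged (fun j => 'I_(2 ^ j)) k.

Definition Omega (R : realType) := Lambda -> R[i].

Section asymptotic_profile.
Context {R : realType}.
Implicit Types (x y : Omega R) (nu : R -> \bar R).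

Definition big_count x (t : R) (j : nat) : nat :=
  #|[set k : 'I_(2 ^ j) | t <= normc (x (idx k))]%SET|.

(* [lne 0 = -oo]; the value at j = 0, where the denominator vanishes, is
   irrelevant to the upper limit. *)
Definition limsup_density x (a : R) : \bar R :=
  limn_esup (fun j : nat => (lne (big_count x (2 `^ (- a * j%:R)) j)%:R%:E
    * ((ln (2 ^+ j))^-1)%:E)%E).

Definition asymptotic_profile x (a : R) : \bar R :=
  lim (limsup_density x (a + e) @[e --> (0 : R)^'+]).

Definition S_set nu : set (Omega R) :=
  [set x | forall a : R, (asymptotic_profile x a <= nu a)%E].

Definition delta (l : Lambda) : Omega R := fun l' => (l' == l)%:R.

End asymptotic_profile.

Record admissible_profile (R : realType) := AdmissibleProfile {
  profile :> R -> \bar R ;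
  profile_range : forall a, profile a = -oo%E \/ (0 <= profile a <= 1)%E ;
  profile_nondecreasing : {homo profile : a b / a <= b >-> (a <= b)%E} ;
  profile_right_continuous : forall a, profile b @[b --> a^'+] --> profile a ;
  profile_nontrivial : exists a, profile a != -oo%E }.

Section profiles.
Context {R : realType}.
Implicit Types nu : R -> \bar R.
Local Open Scope ereal_scope.

Definition alpha_min nu : \bar R := ereal_inf [set a%:E | a in [set a | 0 <= nu a]].

Definition clip (b : \bar R) : \bar R :=
  if b < 0 then -oo else if b <= 1 then b else 1.

Definition dual_profile nu : R -> \bar R := fun a' =>
  clip (a'%:E + ereal_inf [set a%:E | a in [set a | nu a - a%:E > a'%:E]]).

Definition shift_profile nu (e : R) : R -> \bar R := fun a => nu (a - e)%R.

End profiles.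

Section E_space.
Context {R : realType}.
Implicit Types (x y : Omega R) (a : R) (b : \bar R).

(* [2 ^ (b * j)], with the convention that it vanishes for [b = -oo].
   [b = +oo] is a junk value. *)
Definition pow2 b (j : nat) : R := if b is r%:E then 2 `^ (r * j%:R) else 0.

Definition Ebound a b x : set R := [set C : R | 0 <= C /\
  forall j, (big_count x (C * 2 `^ (- a * j%:R)) j)%:R <= C * pow2 b j].

Definition Edist0 a b x : \bar R := ereal_inf [set C%:E | C in Ebound a b x].

Record E_space a b := ESpace {
  E_val :> Omega R ;
  E_valP : `[< (Edist0 a b E_val < +oo)%E >] }.

HB.instance Definition _ a b := [isSub for @E_val a b].
HB.instance Definition _ a b := [Choice of E_space a b by <:].

Definition Edist a b (x y : E_space a b) : R :=
  fine (Edist0 a b (E_val x - E_val y)).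

Lemma pow2_ge0 b j : 0 <= pow2 b j.
Proof. by case: b => [r| |] //=; exact: powR_ge0. Qed.

Lemma big_count_le x (t t' : R) j : t <= t' ->
  (big_count x t' j <= big_count x t j)%N.
Proof.
move=> tt'; apply: subset_leq_card; apply/fintype.subsetP => k.
by rewrite !inE; exact: le_trans.
Qed.

Lemma big_countN x t j : big_count (- x) t j = big_count x t j.
Proof. by apply: eq_card => k; rewrite !inE normcN. Qed.

Lemma big_countD x y (t s : R) j :
  (big_count (x + y)%R (t + s)%R j <= big_count x t j + big_count y s j)%N.
Proof.
rewrite /big_count -cardsUI; apply: leq_trans (leq_addr _ _).
apply: subset_leq_card; apply/fintype.subsetP => k; rewrite !inE => h.
rewrite -implyNb; apply/implyP; rewrite -ltNge => h1.
rewrite leNgt; apply/negP => h2.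
have := le_trans h (le_normcD (x (idx k)) (y (idx k))).
by rewrite leNgt ltrD.
Qed.

Lemma Ebound_up a b x C D : Ebound a b x C -> C <= D -> Ebound a b x D.
Proof.
move=> [C0 h] CD; split; first exact: le_trans CD.
move=> j; apply: le_trans (le_trans (h j) _).
  by rewrite ler_nat; apply: big_count_le; rewrite ler_wpM2r// powR_ge0.
by rewrite ler_wpM2r// pow2_ge0.
Qed.

Lemma EboundD a b x y C D : Ebound a b x C -> Ebound a b y D -> Ebound a b (x + y) (C + D).
Proof.
move=> [C0 h] [D0 g]; split; first exact: addr_ge0.
move=> j; rewrite !mulrDl; apply: le_trans (lerD (h j) (g j)).
by rewrite -natrD ler_nat; exact: big_countD.
Qed.

Lemma Edist0_ge0 a b x : (0 <= Edist0 a b x)%E.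
Proof. by apply: le_ereal_inf_tmp => _ [C [C0 _] <-]; rewrite lee_fin. Qed.

Lemma Edist0_ltP a b x (r : R) : (Edist0 a b x < r%:E)%E <->
  exists2 C, Ebound a b x C & C < r.
Proof.
split; first by move=> /ereal_inf_lt[_ [C AC <-]]; rewrite lte_fin; exists C.
move=> [C AC Cr]; apply: (@le_lt_trans _ _ C%:E); last by rewrite lte_fin.
by apply: ereal_inf_lbound; exists C.
Qed.

Lemma Edist0_fin a b x : (Edist0 a b x < +oo)%E -> Edist0 a b x \is a fin_num.
Proof. by move=> h; rewrite ge0_fin_numE// Edist0_ge0. Qed.

Lemma Edist0N a b x : Edist0 a b (- x) = Edist0 a b x.
Proof.
rewrite /Edist0; congr (ereal_inf (_ @` _)).
by apply/seteqP; split => C /= [C0 h]; split=> // j; move: (h j);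
  rewrite big_countN.
Qed.

Lemma Edist0D a b x y : (Edist0 a b x < +oo -> Edist0 a b y < +oo ->
  Edist0 a b (x + y)%R <= Edist0 a b x + Edist0 a b y)%E.
Proof.
move=> /Edist0_fin xf /Edist0_fin yf.
apply/lee_addgt0Pr => e e0.
have e2 : 0 < e / 2 by rewrite divr_gt0.
have hx : (Edist0 a b x < (fine (Edist0 a b x) + e / 2)%:E)%E.
  by rewrite -{1}(fineK xf) lte_fin ltrDl.
have hy : (Edist0 a b y < (fine (Edist0 a b y) + e / 2)%:E)%E.
  by rewrite -{1}(fineK yf) lte_fin ltrDl.
have [C AC Cx] := (Edist0_ltP _ _ _ _).1 hx.
have [D AD Dy] := (Edist0_ltP _ _ _ _).1 hy.
rewrite -(fineK xf) -(fineK yf) -!EFinD.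
apply: (@le_trans _ _ (C + D)%:E); last by rewrite lee_fin; lra.
by apply: ereal_inf_lbound; exists (C + D) => //; exact: EboundD.
Qed.

Lemma EdistB_fin a b (x y : E_space a b) :
  (Edist0 a b (E_val x - E_val y)%R < +oo)%E.
Proof.
case: x y => [x /asboolP xP] [y /asboolP yP] /=.
apply: le_lt_trans (Edist0D xP _) _; rewrite Edist0N//.
by rewrite lte_add_pinfty.
Qed.

Lemma Edist_sym a b (x y : E_space a b) : Edist x y = Edist y x.
Proof. by rewrite /Edist -[in RHS]Edist0N opprB. Qed.

Lemma Edist_triangle a b (y x z : E_space a b) :
  Edist x z <= Edist x y + Edist y z.
Proof.
have := Edist0D (EdistB_fin x y) (EdistB_fin y z).
have -> : E_val x - E_val y + (E_val y - E_val z) = E_val x - E_val z.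
  by rewrite addrA subrK.
have := (Edist0_fin (EdistB_fin x y), Edist0_fin (EdistB_fin y z)).
have := Edist0_fin (EdistB_fin x z); rewrite /Edist.
move: (Edist0 _ _ _) (Edist0 _ _ _) (Edist0 _ _ _) => u v w uf [vf wf] h.
by rewrite -fineD// fine_le// fin_numD vf.
Qed.

Lemma Edist0_0 a b : Edist0 a b 0 = 0%E.
Proof.
apply/eqP; rewrite eq_le Edist0_ge0 andbT; apply/lee_addgt0Pr => e e0.
rewrite add0e; apply: ereal_inf_lbound; exists e => //; split; first exact: ltW.
move=> j; rewrite (_ : big_count _ _ _ = 0%N) ?mulr_ge0 ?pow2_ge0 ?ltW//.
apply: eq_card0 => k; rewrite !inE [X in normc X](_ : _ = 0)// normc0.
apply/negbTE; rewrite -ltNge.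
by rewrite mulr_gt0// powR_gt0.
Qed.

Lemma Edist_xx a b (x : E_space a b) : Edist x x = 0.
Proof. by rewrite /Edist subrr Edist0_0. Qed.

Lemma Edist_eq0 a b (x y : E_space a b) : Edist x y = 0 -> x = y.
Proof.
move=> xy0; apply: val_inj => /=; apply/eqP; rewrite -subr_eq0; apply/eqP.
have /eqP : Edist0 a b (E_val x - E_val y) = 0%E.
  by rewrite -(fineK (Edist0_fin (EdistB_fin x y))) -/(Edist _ _) xy0.
set z := _ - _ => z0; apply/funext => -[j k]; apply: eq0_normc.
apply/eqP; rewrite eq_le; apply/andP; split; last first.
  by case: (z _) => ? ?; rewrite sqrtr_ge0.
apply/ler_addgt0Pr => e e0; rewrite add0r.
pose p := 2 `^ (- a * j%:R) : R.
have p0 : 0 < p by rewrite powR_gt0.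
pose r := Num.min (e / p) (pow2 b j + 1)^-1.
have q0 : 0 < pow2 b j + 1 by rewrite ltr_wpDl ?pow2_ge0.
have r0 : 0 < r by rewrite lt_min divr_gt0//= invr_gt0.
have [|C [C0 hC] Cr] := (Edist0_ltP a b z r).1; first by rewrite (eqP z0) lte_fin.
have := hC j; have : C * pow2 b j < 1.
  move: Cr; rewrite lt_min => /andP[_ Cr].
  apply: (@le_lt_trans _ _ (C * (pow2 b j + 1))); first by rewrite ler_wpM2l// lerDl.
  by rewrite -ltr_pdivlMr// div1r.
move=> /[swap] /le_lt_trans /[apply]; rewrite -[X in _ < X](mulr1n 1) ltr_nat ltnS leqn0.
move=> /eqP /card0_eq /(_ k); rewrite !inE => /negbT; rewrite -ltNge -/p => /ltW zC.
apply: le_trans zC _; rewrite -ler_pdivlMr// ltW//.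
by move: Cr; rewrite lt_min => /andP[].
Qed.

HB.instance Definition _ a b := @isMetric.Build R (E_space a b) (@Edist a b)
  (@Edist_xx a b) (@Edist_eq0 a b) (@Edist_sym a b) (@Edist_triangle a b).

End E_space.

Section S_set_theory.
Context {R : realType}.
Implicit Types (x y : Omega R) (nu : R -> \bar R).

Lemma limn_esup_lt (u : nat -> \bar R) (c : \bar R) : (limn_esup u < c)%E ->
  exists J, forall j, (J <= j)%N -> (u j <= c)%E.
Proof.
move=> /ereal_inf_lt[_ [V [J _ JV] <-]] Vc; exists J => j Jj.
apply: le_trans (ltW Vc); apply: ereal_sup_ubound; exists j => //.
exact: JV.
Qed.

Lemma limn_esup_le (u : nat -> \bar R) (c : \bar R) (J : nat) :
  (forall j, (J <= j)%N -> (u j <= c)%E) -> (limn_esup u <= c)%E.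
Proof.
move=> uc; apply: (@le_trans _ _ (ereal_sup (u @` [set j | (J <= j)%N]))).
  by apply: ereal_inf_lbound; exists [set j | (J <= j)%N] => //; exists J.
by apply: ge_ereal_sup => _ [j /= Jj <-]; exact: uc.
Qed.

Lemma le_limn_esup (u v : nat -> \bar R) : (forall j, (u j <= v j)%E) ->
  (limn_esup u <= limn_esup v)%E.
Proof.
move=> uv; apply: le_ereal_inf_tmp => _ [V VF <-].
apply: (@le_trans _ _ (ereal_sup (u @` V))).
  by apply: ereal_inf_lbound; exists V.
apply: ge_ereal_sup => _ [j Vj <-]; apply: le_trans (uv j) _.
by apply: ereal_sup_ubound; exists j.
Qed.

Lemma lee_ltEFinP (x b : \bar R) :
  (forall c : R, (b < c%:E)%E -> (x <= c%:E)%E) -> (x <= b)%E.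
Proof.
case: b => [b| |] h; last 2 first.
- exact: leey.
- case: x h => [r| |] h //.
    by have := h (r - 1) (ltNyr _); rewrite lee_fin => /le_gtF; rewrite ltrBlDr ltrDl ltr01.
  by have := h 0 (ltNyr _).
by apply/lee_addgt0Pr => e e0; rewrite -EFinD h// lte_fin ltrDl.
Qed.

Lemma log_count_le (N j : nat) (c : R) : (0 < j)%N ->
  (lne N%:R%:E * ((ln (2 ^+ j))^-1)%:E <= c%:E)%E = (N%:R <= 2 `^ (c * j%:R)).
Proof.
move=> j0.
have l2 : 0 < ln (2 ^+ j) :> R by rewrite ln_gt0// exprn_egt1// ?ltr1n// -lt0n.
case: N => [|N].
  rewrite powR_ge0 le0_lneNy// mulNyr gtr0_sg ?invr_gt0// mul1e.
  by rewrite leNye.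
have N0 : 0 < N.+1%:R :> R by rewrite ltr0n.
rewrite lne_EFin// -EFinM lee_fin ler_pdivrMr// lnXn//.
rewrite -[in RHS]ler_ln ?posrE ?powR_gt0// ln_powR.
by rewrite -[ln 2 *+ j]mulr_natl mulrA.
Qed.

Let u_ x a (e : R) := limsup_density x (a + e).

Lemma u_nd x a : {homo u_ x a : e f / e <= f >-> (e <= f)%E}.
Proof.
move=> e f ef; apply: le_limn_esup => j.
have [->|j0] := posnP j.
  by rewrite !mulr0.
have l2 : 0 < ln (2 ^+ j) :> R by rewrite ln_gt0// exprn_egt1// ?ltr1n// -lt0n.
apply: lee_wpmul2r; first by rewrite lee_fin invr_ge0 ltW.
rewrite lee_lne ?in_itv/= ?lee_fin ?ler0n ?leey// ler_nat.
apply: big_count_le; rewrite ler_powR ?ler1n// ler_wpM2r//.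
by rewrite lerN2 lerD2l.
Qed.

Lemma asymptotic_profileE x a :
  asymptotic_profile x a = ereal_inf [set u_ x a e | e in [set e | 0 < e]].
Proof.
apply: cvg_lim => //.
have -> : [set e : R | 0 < e] = [set` `]0, +oo[].
  by apply/seteqP; split => e /=; rewrite in_itv/= andbT.
apply: (@nondecreasing_at_right_cvge _ (u_ x a) 0 +oo%O) => //.
by move=> e f _ _; exact: u_nd.
Qed.

Definition eventually_few x (a c : R) := exists2 e : R, 0 < e &
  exists J : nat, forall j, (J <= j)%N ->
    (big_count x (2 `^ (- (a + e) * j%:R)) j)%:R <= 2 `^ (c * j%:R).

Lemma asymptotic_profile_leP x a (b : \bar R) :
  (asymptotic_profile x a <= b)%E <->
  (forall c : R, (b < c%:E)%E -> eventually_few x a c).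
Proof.
rewrite asymptotic_profileE; split.
  move=> h c bc; have /ereal_inf_lt[_ [e /= e0 <-]] := le_lt_trans h bc.
  move=> /limn_esup_lt[J hJ]; exists e => //; exists J.+1 => j Jj.
  rewrite -log_count_le ?(leq_ltn_trans _ Jj)//.
  by apply: hJ; exact: ltnW.
move=> h; apply: lee_ltEFinP => c bc.
have [e e0 [J hJ]] := h c bc.
apply: (@le_trans _ _ (u_ x a e)); first by apply: ereal_inf_lbound; exists e.
apply: (@limn_esup_le _ _ J.+1) => j Jj.
rewrite log_count_le ?(leq_ltn_trans _ Jj)//.
by apply: hJ; exact: ltnW.
Qed.


Lemma powR2_unbounded (M e : R) : 0 < e ->
  exists J : nat, forall j, (J <= j)%N -> M <= 2 `^ (e * j%:R).
Proof.
move=> e0; pose m := Num.trunc `|M|.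
exists (Num.trunc (m.+1%:R / e)).+1 => j Jj.
apply: (@le_trans _ _ (2 `^ m.+1%:R)).
  rewrite powR_mulrn//; apply: (@le_trans _ _ m.+1%:R).
    by apply: le_trans (ler_norm _) (ltW (truncnS_gt _)).
  by rewrite -natrX ler_nat ltnW// ltn_expl.
rewrite ler_powR ?ler1n// -ler_pdivrMl// mulrC.
apply: ltW; apply: lt_le_trans (truncnS_gt _) _.
by rewrite ler_nat.
Qed.

Lemma eventually_few0 a c : eventually_few 0 a c.
Proof.
exists 1 => //; exists 0%N => j _.
rewrite (_ : big_count _ _ _ = 0%N) ?powR_ge0//.
apply: eq_card0 => k; rewrite !inE [X in normc X](_ : _ = 0)// normc0.
by apply/negbTE; rewrite -ltNge powR_gt0.
Qed.

Lemma eventually_few_lin (l : R[i]) x y a c d : c < d ->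
  eventually_few x a c -> eventually_few y a c -> eventually_few (l *: x + y) a d.
Proof.
move=> cd [e e0 [J hJ]] [f f0 [K hK]].
pose g := Num.min e f; have g0 : 0 < g by rewrite lt_min e0.
pose M := 2 * (1 + normc l).
have nl0 : 0 <= normc l by case: l @M => ? ?; rewrite sqrtr_ge0.
have M0 : 0 < M by rewrite mulr_gt0// ltr_pwDl.
have g20 : 0 < g / 2 by rewrite divr_gt0.
have [L hL] := powR2_unbounded M g20.
have dc0 : 0 < d - c by rewrite subr_gt0.
have [N hN] := powR2_unbounded 2 dc0.
exists (g / 2) => //; exists (maxn (maxn J K) (maxn L N)) => j.
rewrite !geq_max => /andP[/andP[Jj Kj] /andP[Lj Nj]].
have key h : g <= h -> M * 2 `^ (- (a + h) * j%:R) <= 2 `^ (- (a + g / 2) * j%:R).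
  move=> gh; apply: (@le_trans _ _ (2 `^ (g / 2 * j%:R) * 2 `^ (- (a + h) * j%:R))).
    by rewrite ler_wpM2r ?powR_ge0// hL.
  rewrite -powRD ?pnatr_eq0 ?implybT// ler_powR ?ler1n// -mulrDl ler_wpM2r//.
  by lra.
have ke : M * 2 `^ (- (a + e) * j%:R) <= 2 `^ (- (a + g / 2) * j%:R).
  by apply: key; rewrite ge_min lexx.
have kf : M * 2 `^ (- (a + f) * j%:R) <= 2 `^ (- (a + g / 2) * j%:R).
  by apply: key; rewrite ge_min lexx orbT.
set t := 2 `^ (- (a + g / 2) * j%:R) in ke kf *.
apply: (@le_trans _ _ (2 `^ (c * j%:R) + 2 `^ (c * j%:R))); last first.
  rewrite -mulr2n -[_ *+ 2]mulr_natl (_ : d = (d - c) + c); last by rewrite subrK.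
  rewrite [((_ - _) + _) * _]mulrDl powRD ?pnatr_eq0 ?implybT//.
  by rewrite ler_wpM2r ?powR_ge0// hN.
apply: le_trans (lerD (hJ _ Jj) (hK _ Kj)); rewrite -natrD ler_nat.
rewrite /big_count -cardsUI; apply: leq_trans (leq_addr _ _).
apply: subset_leq_card; apply/fintype.subsetP => k; rewrite !inE => h.
rewrite -implyNb; apply/implyP; rewrite -ltNge => h1.
rewrite leNgt; apply/negP => h2.
have := le_trans h (le_normcD (l * x (idx k)) (y (idx k))).
rewrite normcM leNgt => /negP; apply.
move: h1 h2 ke kf; set p := 2 `^ _; set q := 2 `^ _; rewrite /M => h1 h2 ke kf.
have ? : 0 < p by exact: powR_gt0.
have ? : 0 < q by exact: powR_gt0.
nra.
Qed.

Definition S_pred nu : {pred Omega R} := fun x => `[< S_set nu x >].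

Lemma S_submod nu : submod_closed (S_pred nu).
Proof.
split.
  by apply/asboolP => a; apply/asymptotic_profile_leP => c _; exact: eventually_few0.
move=> l x y /asboolP xS /asboolP yS; apply/asboolP => a.
apply/asymptotic_profile_leP => c; case: (ltgtP (nu a) c%:E) => // nuc _.
have [d nud dc] : exists2 d : R, (nu a < d%:E)%E & d < c.
  case: (nu a) nuc => [r| |] //; last first.
    by exists (c - 1) => //; rewrite ?ltNyr// gtrBl.
  by rewrite lte_fin => /midf_lt[? ?]; exists ((r + c) / 2).
apply: (@eventually_few_lin l x y a d c) => //.
- exact: (asymptotic_profile_leP x a (nu a)).1.
- exact: (asymptotic_profile_leP y a (nu a)).1.
Qed.

HB.instance Definition _ nu :=
  GRing.isSubmodClosed.Build R[i] (Omega R) (S_pred nu) (S_submod nu).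

Record S_space nu := SSpace { S_val :> Omega R ; S_valP : S_val \in S_pred nu }.

HB.instance Definition _ nu := [isSub for @S_val nu].
HB.instance Definition _ nu := [Choice of S_space nu by <:].
HB.instance Definition _ nu :=
  [SubChoice_isSubLmodule of S_space nu by <:].

Lemma delta_in_S nu (l : Lambda) : delta l \in S_pred nu.
Proof.
apply/asboolP => a; apply/asymptotic_profile_leP => c _.
exists 1 => //; exists (tag l).+1 => j lj.
rewrite (_ : big_count _ _ _ = 0%N) ?powR_ge0//.
apply: eq_card0 => k; rewrite !inE /delta.
have /negbTE -> : idx k != l.
  by apply: contraTneq lj => <-; rewrite ltnn.
by rewrite normc0; apply/negbTE; rewrite -ltNge powR_gt0.
Qed.

Definition S_delta nu (l : Lambda) : S_space nu := SSpace (delta_in_S nu l).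

Lemma S_sub_E (nu : admissible_profile R) (a : R) (e : {posnum R}) x :
  x \in S_pred nu -> `[< (Edist0 a (nu a + e%:num%:E) x < +oo)%E >].
Proof.
move=> /asboolP /(_ a) /asymptotic_profile_leP h; apply/asboolP.
set b := (nu a + _)%E.
have [J hJ] : exists J : nat, forall j, (J <= j)%N ->
    (big_count x (2 `^ (- a * j%:R)) j)%:R <= pow2 b j.
  have mono j f : 0 < f ->
      (big_count x (2 `^ (- a * j%:R)) j <= big_count x (2 `^ (- (a + f) * j%:R)) j)%N.
    move=> f0; apply: big_count_le; rewrite ler_powR ?ler1n// ler_wpM2r//.
    by rewrite lerN2 lerDl ltW.
  rewrite /b; case: (nu a) (profile_range nu a) h => [r| |] hr h.
  - have [f f0 [J hJ]] := h (r + e%:num) (ltac:(by rewrite lte_fin ltrDl)).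
    exists J => j Jj; apply: le_trans (hJ _ Jj).
    by rewrite ler_nat mono.
  - by case: hr => // /andP[_]; rewrite leye_eq.
  - have [f f0 [J hJ]] := h (-1) (ltNyr _).
    exists J.+1 => j Jj /=; have := hJ j (ltnW Jj).
    have j0 : (0 < j)%N by exact: leq_ltn_trans Jj.
    have : 2 `^ (-1 * j%:R) < 1 :> R.
      by rewrite mulN1r powRN powR_mulrn// invf_lt1 ?exprn_gt0// exprn_egt1 ?ltr1n// -lt0n.
    move=> /[swap] /le_lt_trans /[apply].
    rewrite -[X in _ < X](mulr1n 1) ltr_nat ltnS leqn0 => /eqP N0.
    by have := mono j f f0; rewrite N0 leqn0 => /eqP ->.
have n0 (z : R[i]) : 0 <= normc z by case: z => ? ?; rewrite sqrtr_ge0.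
pose S (j : nat) : R := \sum_k normc (x (@idx j k)) * 2 `^ (a * j%:R).
have S0 j : 0 <= S j by apply: sumr_ge0 => k _; rewrite mulr_ge0 ?powR_ge0.
pose C : R := 1 + \sum_(j < J) S j.
have C1 : 1 <= C by rewrite lerDl sumr_ge0.
have C0 : 0 <= C by exact: le_trans C1.
apply: le_lt_trans (ltry C); apply: ereal_inf_lbound; exists C => //.
split=> // j; have [Jj|jJ] := leqP J j.
  apply: (@le_trans _ _ (pow2 b j)); last by rewrite ler_peMl ?pow2_ge0.
  apply: le_trans (hJ j Jj); rewrite ler_nat; apply: big_count_le.
  by rewrite ler_peMl ?powR_ge0.
rewrite (_ : big_count _ _ _ = 0%N) ?mulr_ge0 ?pow2_ge0//.
apply: eq_card0 => k; rewrite !inE; apply/negbTE; rewrite -ltNge.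
rewrite mulNr powRN -ltr_pdivrMr ?invr_gt0 ?powR_gt0// invrK.
apply: (@le_lt_trans _ _ (S j)).
  rewrite /S (bigD1 k)//= lerDl sumr_ge0// => i _.
  by rewrite mulr_ge0 ?powR_ge0.
apply: (@le_lt_trans _ _ (\sum_(j < J) S j)); last by rewrite ltrDr.
rewrite (bigD1 (Ordinal jJ))//= lerDl sumr_ge0//.
Qed.

End S_set_theory.


(* The same vector space, with the topology attached to the sequences
   [alpha] and [eps]. *)
Definition S_top (R : realType) (nu : admissible_profile R)
  (alpha : nat -> R) (eps : nat -> {posnum R}) : Type := S_space nu.

Section S_topology.
Context {R : realType} (nu : admissible_profile R).
Context (alpha : nat -> R) (eps : nat -> {posnum R}).

HB.instance Definition _ := GRing.Lmodule.on (S_top nu alpha eps).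

Definition S_incl (nm : nat * nat) (x : S_space nu) :
    E_space (alpha nm.1) (nu (alpha nm.1) + (eps nm.2)%:num%:E)%E :=
  ESpace (S_sub_E (alpha nm.1) (eps nm.2) (S_valP x)).

HB.instance Definition _ := Topological.copy (S_top nu alpha eps)
  (sup_topology (fun nm : nat * nat =>
    Topological.class (initial_topology (S_incl nm)))).

End S_topology.

Definition topological_dual (K : numFieldType) (E : preTopologicalLmodType K) :
  set {linear E -> K^o} := [set u | continuous u].
Arguments topological_dual {K} E _.

Definition coef_seq (R : realType) (nu : admissible_profile R)
    (alpha : nat -> R) (eps : nat -> {posnum R})
    (u : {linear S_top nu alpha eps -> R[i]^o}) : Omega R :=
  fun l => (u (S_delta nu l : S_top nu alpha eps))^*.

(* Unconditional summation, along the net of finite subsets of [I]. *)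
Definition has_sum (I : choiceType) (K : numFieldType) (f : I -> K^o) (s : K^o) :=
  summability.partial_sum f @ summability.totally --> s.

(* Main.v *)
Require Import Defs.
From HB Require Import structures.
From mathcomp Require Import all_boot all_order all_algebra finmap.
From mathcomp Require Import complex.
From mathcomp Require Import all_classical all_reals all_analysis.
From mathcomp Require Import lra ring.
From mathcomp.analysis.showcase Require summability.

Set Implicit Arguments.
Unset Strict Implicit.
Unset Printing Implicit Defensive.

Import Order.TTheory GRing.Theory Num.Theory.
Import numFieldNormedType.Exports.
Import ComplexField.Normc.

Local Open Scope classical_set_scope.
Local Open Scope ring_scope.
Local Open Scope complex_scope.

(* If [u] is continuous, it is bounded on a neighbourhood of 0 given by finitely many
   pairs (alpha_i, beta_i), beta_i = nu(alpha_i) + eps_i. By right-continuity there is e > 0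
   with nu(alpha_i + 2e) <= nu(alpha_i) + eps_i / 2 for all i. If, at level j, too many of
   the y_{j,k} had modulus at least 2^{-(a' + e/2) j}, then, with
   a = inf {al : nu(al) - al > a' - e}, the sequence carried by those k, of modulus
   2^{-(a - 2e) j} and with phases making all the terms of u(x) positive, would belong to
   this neighbourhood for large j, while u(x) is large.
   Conversely, at every pair of exponents (a, a') one has nu(a) <= a + a' - e or
   nu'(a' - e) <= a + a' - e. On a fine finite grid of exponents this bounds the number of
   k with x_{j,k} of order 2^{-a j} and y_{j,k} of order 2^{-a' j}, so that
   sum_k |x_{j,k} y_{j,k}| decays geometrically in j, uniformly over a neighbourhood. *)

(** * Preliminaries *)

Section complex_modulus.
Context {R : realType}.
Implicit Types (r : R) (z : R[i]).

Lemma normc_ge0 z : 0 <= normc z.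
Proof. by case: z => ? ?; rewrite sqrtr_ge0. Qed.

Lemma normc_real r : normc r%:C = `|r|.
Proof. by rewrite /normc/= expr0n addr0 sqrtr_sqr. Qed.

Lemma normc_conj z : normc (Num.conj z) = normc z.
Proof. by apply: complexI; exact: norm_conjC. Qed.

Lemma normc_le_Re_Im z : normc z <= `|complex.Re z| + `|complex.Im z|.
Proof.
case: z => a b /=; rewrite -[leRHS]ger0_norm ?addr_ge0// -sqrtr_sqr.
rewrite ler_sqrt ?sqr_ge0// sqrrD !real_normK ?num_real//.
by rewrite addrAC lerDl mulrn_wge0// mulr_ge0.
Qed.

Lemma Re_le_normc z : `|complex.Re z| <= normc z.
Proof. by rewrite -lecR; exact: normc_ge_Re. Qed.

Lemma Im_le_normc z : `|complex.Im z| <= normc z.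
Proof.
case: z => a b /=; rewrite -sqrtr_sqr ler_sqrt ?addr_ge0 ?sqr_ge0//.
by rewrite lerDr sqr_ge0.
Qed.

Lemma posC_real z : 0 < z -> exists2 r, 0 < r & z = r%:C.
Proof.
by case: z => a b; rewrite ltcE /= => /andP[/eqP -> a0]; exists a.
Qed.

End complex_modulus.

Section powers_of_two.
Context {R : realType}.

Lemma powR2D (x y : R) : 2 `^ (x + y) = 2 `^ x * 2 `^ y.
Proof. by rewrite powRD// pnatr_eq0 implybT. Qed.

Lemma powR2_lower (C e : R) : 0 < C -> 0 < e ->
  \forall j \near \oo, 2 `^ (- e * j%:R) < C.
Proof.
move=> C0 e0; have [J hJ] := powR2_unbounded (C^-1 + 1) e0.
exists J => // j /= /hJ h; rewrite mulNr powRN invf_plt ?posrE ?powR_gt0//.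
by apply: lt_le_trans h; rewrite ltrDl.
Qed.

End powers_of_two.

Lemma subset_of_card (T : finType) (A : {set T}) n : (n <= #|A|)%N ->
  exists2 B : {set T}, B \subset A & #|B| = n.
Proof.
move=> nA; exists [set x in take n (enum A)]%SET.
  by apply/fintype.subsetP => x; rewrite inE => /mem_take; rewrite mem_enum.
rewrite cardsE (card_uniqP _) ?take_uniq ?enum_uniq// size_takel//.
by rewrite -cardE.
Qed.


Lemma filter_seq_forall (T : eqType) (U : Type) (F : set_system U) (s : seq T)
    (P : T -> U -> Prop) : Filter F ->
  (forall t, t \in s -> \forall x \near F, P t x) ->
  \forall x \near F, forall t, t \in s -> P t x.
Proof.
move=> FF; elim: s => [|t s IH] h; first exact: nearW.
have ht := h t (mem_head _ _).
have hs : \forall x \near F, forall t, t \in s -> P t x.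
  by apply: IH => r rs; apply: h; rewrite in_cons rs orbT.
near=> x => r; rewrite in_cons => /predU1P[->|]; first by near: x.
by move: r; near: x.
Unshelve. all: by end_near.
Qed.

Lemma linear_ext (K : pzSemiRingType) (U : lSemiModType K) (V : nmodType)
  (s : K -> V -> V) (f g : {linear U -> V | s}) : f =1 g -> f = g.
Proof.
case: f g => [f [[fD] [fZ]]] [g [[gD] [gZ]]] /= /funext fg; subst g.
by rewrite (Prop_irrelevance fD gD) (Prop_irrelevance fZ gZ).
Qed.

Lemma exists_linear (K : pzRingType) (U V : lmodType K) (f : U -> V) :
  linear f -> exists u : {linear U -> V}, u =1 f.
Proof.
move=> fl; pose m := GRing.isLinear.Build K U V *:%R f fl.
by exists (HB.pack_for {linear U -> V} f m).
Qed.

Lemma limn_linear (K : numFieldType) (V : normedModType K) (l : K) (f g : nat -> V) :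
  cvgn f -> cvgn g -> limn (fun n => l *: f n + g n) = l *: limn f + limn g.
Proof.
move=> fc gc; apply: cvg_lim; first exact: norm_hausdorff.
by apply: cvgD => //; exact: cvgZl_tmp.
Qed.

(** * The topology of S^nu *)

Section S_topology_theory.
Context {R : realType} (nu : admissible_profile R).
Context (alpha : nat -> R) (eps : nat -> {posnum R}).
Implicit Types (p : nat * nat) (x y : Omega R) (d : R).
Local Notation S := (S_top nu alpha eps).

Definition Sbound p : \bar R := (nu (alpha p.1) + (eps p.2)%:num%:E)%E.

(** The condition [Edist0 (alpha p.1) (Sbound p) x < d], in the form given by [Edist0_ltP]. *)
Definition Sclose p d x := exists2 C, Ebound (alpha p.1) (Sbound p) x C & C < d.

Lemma S_incl_distP p d (x y : S_space nu) :
  Edist (S_incl alpha eps p x) (S_incl alpha eps p y) < d <->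
  Sclose p d (S_val x - S_val y).
Proof.
rewrite /Sclose -Edist0_ltP /Edist.
have h := Edist0_fin (EdistB_fin (S_incl alpha eps p x) (S_incl alpha eps p y)).
by rewrite -[in X in _ <-> X](fineK h) lte_fin.
Qed.

(** Convergence in a supremum of topologies is convergence in each of them, and each one here is
    pulled back from a metric, so balls suffice. *)
Lemma S_top_cvgP (F : set_system S) (x : S) : Filter F ->
  F --> x <-> forall p d, 0 < d -> \forall y \near F, Sclose p d (S_val y - S_val x).
Proof.
move=> FF; split.
  move=> /cvg_sup Fx p d d0.
  have : nbhs (x : initial_topology (S_incl alpha eps p))
     (S_incl alpha eps p @^-1` ball (S_incl alpha eps p x) d).
    by apply: initial_continuous; exact: nbhsx_ballx.
  move=> /(Fx p); apply: filterS => y /=; rewrite ballEmdist /= => h.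
  by apply/S_incl_distP; rewrite Edist_sym.
move=> h; apply/cvg_sup => p U.
have /= -> := @nbhsE (initial_topology (S_incl alpha eps p)) x.
case=> _ [[B oB <-] /= Bx] /filterS; apply.
have : nbhs (S_incl alpha eps p x) B by exact: open_nbhs_nbhs.
move=> /nbhs_ballP[d /= d0 dB]; have := h p d d0; apply: filterS => y yx.
by apply: dB; rewrite ballEmdist /=; rewrite -[mdist _ _]/(Edist _ _) Edist_sym;
  apply/S_incl_distP.
Qed.

Lemma Sclose_nbhs (x : S) p d : 0 < d ->
  \forall y \near x, Sclose p d (S_val y - S_val x).
Proof. by move=> d0; have /S_top_cvgP/(_ p d d0) := @cvg_id _ (nbhs x). Qed.

(** The sets given by finitely many closeness conditions generate a filter [F]; it converges to [x]
    by [S_top_cvgP], hence contains every neighbourhood of [x]. *)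
Lemma S_nbhs_basis (x : S) (U : set S) : nbhs x U ->
  exists (L : seq (nat * nat)) (d : R), 0 < d /\
    forall y : S, (forall p, p \in L -> Sclose p d (S_val y - S_val x)) -> U y.
Proof.
pose D := [set Ld : seq (nat * nat) * R | 0 < Ld.2].
pose B (Ld : seq (nat * nat) * R) :=
  [set y : S | forall p, p \in Ld.1 -> Sclose p Ld.2 (S_val y - S_val x)].
pose F := filter_from D B.
have FF : Filter F.
  apply: filter_from_filter; first by exists ([::], 1); rewrite /D /=.
  move=> [L d] [M e] /= d0 e0; exists (L ++ M, Num.min d e).
    by rewrite /D /= lt_min d0.
  move=> y /= h; split => p pL /=.
    have [|C Cx] := h p; first by rewrite /= mem_cat pL.
    by rewrite lt_min => /andP[Cd _]; exists C.
  have [|C Cx] := h p; first by rewrite /= mem_cat pL orbT.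
  by rewrite lt_min => /andP[_ Cd]; exists C.
have /[apply] : F --> x.
  apply/S_top_cvgP => p d d0; exists ([:: p], d) => // y /= /(_ p).
  by rewrite mem_seq1 eqxx; exact.
by case=> -[L d] /= d0 h; exists L, d; split.
Qed.

End S_topology_theory.

(** * Approximation by finitely supported sequences *)

Section S_approximation.
Context {R : realType} (nu : admissible_profile R).

(** The margin [e] in the threshold exponent absorbs the factor [C] on the left, the gap [d - c] the
    one on the right. *)
Lemma eventually_few_scale (x : Omega R) (a c d C : R) : 0 < C -> c < d ->
  eventually_few x a c -> exists J, forall j, (J <= j)%N ->
  (big_count x (C * 2 `^ (- a * j%:R)) j)%:R <= C * 2 `^ (d * j%:R).
Proof.
move=> C0 cd [e e0 [J hJ]].
have [K hK] := powR2_unbounded C^-1 e0.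
have dc0 : 0 < d - c by rewrite subr_gt0.
have [L hL] := powR2_unbounded C^-1 dc0.
exists (maxn J (maxn K L)) => j; rewrite !geq_max => /and3P[Jj Kj Lj].
apply: (@le_trans _ _ (big_count x (2 `^ (- (a + e) * j%:R)) j)%:R).
  rewrite ler_nat; apply: big_count_le; rewrite opprD mulrDl addrC powR2D.
  rewrite ler_wpM2r ?powR_ge0// mulNr powRN.
  by rewrite invf_ple ?posrE ?powR_gt0// hK.
apply: le_trans (hJ _ Jj) _.
rewrite -[in leRHS](subrK c d) mulrDl powR2D mulrA ler_peMl ?powR_ge0//.
by rewrite -ler_pdivrMl// mulr1 hL.
Qed.

Lemma S_set_few (x : Omega R) (a C : R) (e : {posnum R}) : S_set nu x -> 0 < C ->
  exists J, forall j, (J <= j)%N ->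
  (big_count x (C * 2 `^ (- a * j%:R)) j)%:R <= C * pow2 (nu a + e%:num%:E) j.
Proof.
move=> /(_ a) /asymptotic_profile_leP h C0.
case: (nu a) (profile_range nu a) h => [r| |] hr h.
- apply: (@eventually_few_scale x a (r + e%:num / 2)) => //.
    by rewrite ltrD2l gtr_pMr// invf_lt1// ltr1n.
  by apply: h; rewrite lte_fin ltrDl.
- by case: hr => // /andP[_]; rewrite leye_eq.
- have [J hJ] := eventually_few_scale C0 (ltrN10 R) (h (-1) (ltNyr _)).
  (* Here [pow2] is 0, so the count itself has to vanish: it is at most [C * 2 ^ (- j)], which is
     below 1 once [C + 1 <= 2 ^ j]. *)
  have N21 : -2 < -1 :> R by lra.
  have [K hK] := eventually_few_scale C0 N21 (h (-2) (ltNyr _)).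
  have [L hL] := powR2_unbounded (C + 1) (@ltr01 R).
  exists (maxn K L) => j; rewrite geq_max => /andP[Kj Lj] /=; rewrite mulr0.
  rewrite -(mulr0n 1) ler_nat leqn0 -leqn0 -ltnS -(ltr_nat R).
  apply: le_lt_trans (hK _ Kj) _.
  rewrite mulN1r powRN ltr_pdivrMr ?powR_gt0// mul1r.
  by have := hL _ Lj; rewrite mul1r; apply: lt_le_trans; rewrite ltrDl.
Qed.

Context (alpha : nat -> R) (eps : nat -> {posnum R}).
Local Notation S := (S_top nu alpha eps).

(** Beyond some level the counts of [x], hence those of anything it dominates, meet the bound with
    constant [d / 2]. Uniformity in [z] serves for truncations of [x] to arbitrary sets of
    indices. *)
Lemma S_tail_Sclose (x : Omega R) p (d : R) : S_set nu x -> 0 < d ->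
  exists J, forall z : Omega R, (forall l, normc (z l) <= normc (x l)) ->
    (forall l, (tag l < J)%N -> z l = 0) -> Sclose nu alpha eps p d z.
Proof.
move=> xS d0; have d20 : 0 < d / 2 by rewrite divr_gt0.
have [J hJ] := S_set_few (alpha p.1) (eps p.2) xS d20.
exists J => z zx z0; exists (d / 2); last by rewrite ltr_pdivrMr// ltr_pMr// ltr1n.
split=> [|j]; first exact: ltW.
have [Jj|jJ] := leqP J j.
  apply: le_trans (hJ _ Jj); rewrite ler_nat; apply: subset_leq_card.
  by apply/fintype.subsetP => k; rewrite !inE => /le_trans; exact.
rewrite (_ : big_count _ _ _ = 0%N) ?mulr_ge0 ?pow2_ge0 ?ltW//.
apply: eq_card0 => k; rewrite !inE z0// normc0; apply/negbTE.
by rewrite -ltNge mulr_gt0// powR_gt0.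
Qed.

Definition S_partial_sum (x : Omega R) (A : {fset Lambda}) : S :=
  \sum_(i : A) x (val i) *: (S_delta nu (val i) : S).

Lemma S_partial_sumE (x : Omega R) A l :
  S_val (S_partial_sum x A) l = if l \in A then x l else 0.
Proof.
rewrite /S_partial_sum (_ : S_val _ =
    \sum_(i : A) x (val i) *: (delta (val i) : Omega R)); last first.
  rewrite -[S_val _]/(\val (\sum_i _ : S_space nu)) linear_sum /=.
  by [].
rewrite fct_sumE; have [lA|lA] := boolP (l \in A).
  rewrite (bigD1 [` lA]%fset)//= big1 => [|i].
    by rewrite addr0 /delta /= !fctE eqxx; exact: mulr1.
  rewrite -val_eqE/= => il; rewrite !fctE /delta eq_sym (negbTE il); exact: mulr0.
rewrite big1// => i _; rewrite !fctE /delta (_ : l == _ = false); first exact: mulr0.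
by apply/negbTE; apply: contraNneq lA => ->; exact: valP.
Qed.

(** Once [A] contains all levels below [J], the remainder vanishes there and is dominated by [x], so
    [S_tail_Sclose] applies whatever else [A] contains. *)
Lemma S_partial_sum_cvg (x : S) : S_partial_sum (S_val x) @ summability.totally --> x.
Proof.
have ? := @summability.totally_filter Lambda.
apply/S_top_cvgP => p d d0.
have /asboolP xS := S_valP x.
have [J hJ] := @S_tail_Sclose (S_val x) p d xS d0.
pose F := [fset l | l in [seq (idx k : Lambda) | j <- iota 0 J, k <- enum 'I_(2 ^ j)]]%fset.
exists F => // A /= FA; apply: hJ.
  move=> l; rewrite -[S_val _ - _]/(fun m => S_val _ m - S_val _ m) /= S_partial_sumE.
  by case: ifP => _; rewrite ?subrr ?normc0 ?normc_ge0// sub0r normcN.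
move=> l lJ; rewrite -[(S_val _ - _) l]/(S_val _ l - S_val _ l) S_partial_sumE.
suff -> : l \in A by rewrite subrr.
move/fsubsetP: FA; apply; rewrite !inE /=; case: l lJ => j k /= jJ.
by apply/allpairsPdep; exists j, k; rewrite mem_iota mem_enum.
Qed.

Lemma dual_has_sum (u : {linear S -> R[i]^o}) (x : S) : topological_dual S u ->
  has_sum (fun l => S_val x l * (coef_seq u l)^*) (u x).
Proof.
move=> uc; have ? := @summability.totally_filter Lambda.
have := cvg_comp _ _ (@S_partial_sum_cvg x) (uc x).
rewrite /has_sum; apply: cvg_trans; apply: near_eq_cvg; apply: nearW => A.
rewrite /= /S_partial_sum /summability.partial_sum linear_sum /=; apply: eq_bigr => i _.
by rewrite linearZ /= /coef_seq conjCK.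
Qed.

End S_approximation.

Section coef_seq_injective.
Context {R : realType} (nu : admissible_profile R).
Context (alpha : nat -> R) (eps : nat -> {posnum R}).
Local Notation S := (S_top nu alpha eps).

Lemma coef_seq_inj : set_inj (topological_dual S) (@coef_seq R nu alpha eps).
Proof.
move=> u v /set_mem uc /set_mem vc uv; apply: linear_ext => x.
have ux := @dual_has_sum R nu alpha eps u x uc.
have vx := @dual_has_sum R nu alpha eps v x vc.
rewrite uv in ux.
have F := @summability.totally_filter Lambda.
have RH : hausdorff_space (R[i]^o) by exact: norm_hausdorff.
exact: (@cvg_unique _ RH _ (fmap_proper_filter _ F) _ _ ux vx).
Qed.
End coef_seq_injective.

(** * Coefficients of a continuous linear form *)

Section admissible_profile_theory.
Context {R : realType} (nu : admissible_profile R).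
Local Open Scope ereal_scope.

(** A profile takes no value strictly between [-oo] and 0, so when [nu a = -oo], being below 0 just
    to the right of [a] already means being [-oo]. *)
Lemma profile_right_step (a c : R) : (0 < c)%R ->
  exists2 h, (0 < h)%R & nu (a + h)%R <= nu a + c%:E.
Proof.
move=> c0.
have [b bc nub] : exists2 b : \bar R, nu a < b &
    forall z, z = -oo \/ (0 <= z <= 1) -> z < b -> z <= nu a + c%:E.
  case: (nu a) (profile_range nu a) => [r| |] hr.
  - exists (r + c)%:E; first by rewrite lte_fin ltrDl.
    by move=> z _ /ltW.
  - by case: hr => // /andP[_]; rewrite leye_eq.
  - by exists 0 => // z [->//|/andP[z0 _]]; rewrite ltNge z0.
have near_a : \forall x \near a^'+, nu x < b /\ (a < x)%R.
  near=> x; split; last by near: x; exact: nbhs_right_gt.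
  near: x; apply: (@profile_right_continuous R nu a [set y | y < b]).
  by apply: open_nbhs_nbhs; split => //; exact: open_ereal_lt_ereal.
have [x [xb ax]] := @filter_ex _ _ (at_right_proper_filter a) _ near_a.
exists (x - a)%R; rewrite ?subr_gt0// addrC subrK.
exact: nub (profile_range nu x) xb.
Unshelve. all: by end_near.
Qed.

(** The factor 2 matches the exponent [i - 2 * e] of the test vectors in [coef_seq_few]. *)
Lemma profile_near_right (a c : R) : (0 < c)%R ->
  \forall h \near 0%R^'+, nu (a + 2 * h)%R <= nu a + c%:E.
Proof.
move=> c0; have [h h0 ah] := profile_right_step a c0.
near=> k; apply: le_trans ah; apply: profile_nondecreasing.
rewrite lerD2l -ler_pdivlMl// mulrC; near: k; apply: nbhs_right_le.
by rewrite divr_gt0.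
Unshelve. all: by end_near.
Qed.

(** The infimum inside the dual profile, whose value at [b] is [clip (b + profile_inf b)]. *)
Definition profile_inf (b : R) : \bar R :=
  ereal_inf [set a%:E | a in [set a | nu a - a%:E > b%:E]].

Lemma profile_gt_ge0 (a b : R) : b%:E < nu a - a%:E -> 0 <= nu a.
Proof.
case: (nu a) (profile_range nu a) => [r| |] [] //.
by move=> /andP[].
Qed.

Lemma alpha_min_le_profile_inf (b : R) : alpha_min nu <= profile_inf b.
Proof.
by apply: ereal_inf_le_tmp => _ [a /= /profile_gt_ge0 a0 <-]; exists a.
Qed.

(** Points [x >= a] with [nu x > b + x] come arbitrarily close to [a]; right-continuity passes the
    inequality to the limit. *)
Lemma profile_inf_le (a b : R) : profile_inf b = a%:E -> (b + a)%:E <= nu a.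
Proof.
move=> ba; apply/lee_addgt0Pr => c c0.
have [h h0 ah] := profile_right_step a c0; apply: le_trans ah.
have /ereal_inf_lt[_ [x /= bx <-]] : profile_inf b < (a + h)%:E.
  by rewrite ba lte_fin ltrDl.
rewrite lte_fin => xh.
have ax : (a <= x)%R by rewrite -lee_fin -ba; apply: ereal_inf_lbound; exists x.
apply: (@le_trans _ _ (nu x)); last by apply: profile_nondecreasing; exact: ltW.
apply: (@le_trans _ _ (b + x)%:E); first by rewrite lee_fin lerD2l.
by rewrite EFinD; apply: ltW; rewrite -lteBrDr.
Qed.

Lemma profile_inf_ge0 (a b : R) : profile_inf b = a%:E -> 0 <= nu a.
Proof.
move=> /profile_inf_le; case: (nu a) (profile_range nu a) => [r| |] [] //.
by move=> /andP[].
Qed.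

End admissible_profile_theory.


(** * Test vectors supported on one level *)

Section coef_seq_profile.
Context {R : realType} (nu : admissible_profile R).
Context (alpha : nat -> R) (eps : nat -> {posnum R}).
Local Notation S := (S_top nu alpha eps).
Implicit Types u : {linear S -> R[i]^o}.

Lemma idx_inj j : injective (@idx j).
Proof. by move=> k k' /eqP; rewrite -tag_eqE /tag_eq eqxx tagged_asE => /eqP. Qed.

Lemma normc_coef_seq u l : normc (coef_seq u l) = normc (u (S_delta nu l : S)).
Proof. exact: normc_conj. Qed.

(* The entries are aligned with the phases of [u] so that no cancellation occurs in [u x]. *)
Lemma aligned_test_vector u (j : nat) (t : R) (A : {set 'I_(2 ^ j)}) : 0 <= t ->
  exists2 x : S, u x = (t * \sum_(k in A) normc (coef_seq u (idx k)))%:C &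
    forall a b C, 0 < C ->
      t < C * 2 `^ (- a * j%:R) \/ #|A|%:R <= C * pow2 b j ->
      Ebound a b (S_val x) C.
Proof.
move=> t0; pose v l : R[i] := u (S_delta nu l : S).
(* [z l] has modulus [t] and the phase conjugate to that of [v l], or is 0 if [v l] is; thus
   [z l * v l] is [t] times the modulus of [v l]. *)
pose z : Omega R := fun l => (t * normc (v l))%:C / v l.
have zt l : normc (z l) <= t.
  rewrite /z normcM normc_real normcV ger0_norm ?mulr_ge0 ?normc_ge0//.
  have [->|v0] := eqVneq (normc (v l)) 0; first by rewrite mulr0 mul0r.
  by rewrite mulfK.
have zv l : z l * v l = (t * normc (v l))%:C.
  rewrite /z; have [->|v0] := eqVneq (v l) 0; first by rewrite normc0 !mulr0.
  by rewrite divfK.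
pose B : {fset Lambda} := [fset (idx k : Lambda) | k in A]%fset.
have idxB j' (k : 'I_(2 ^ j')) : idx k \in B -> j' = j.
  by move=> /imfsetP[k' _ /(congr1 tag)].
exists (@S_partial_sum R nu alpha eps z B).
  rewrite /S_partial_sum linear_sum /= (eq_bigr (fun i : B => (t * normc (v (val i)))%:C)).
    rewrite -(big_seq_fsetE _ _ xpredT (fun l => (t * normc (v l))%:C))/=.
    rewrite big_imfset/=; last by move=> k k' _ _ /idx_inj.
    rewrite big_enum /= mulr_sumr raddf_sum /=.
    by apply: eq_bigr => k _; rewrite normc_coef_seq.
  by move=> i _; rewrite linearZ /= -zv.
move=> a b C C0 h; split; first exact: ltW.
move=> j'; set c := big_count _ _ _.
have [c0|c0] := eqVneq c 0%N; first by rewrite c0 mulr_ge0 ?pow2_ge0// ltW.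
have [k] : exists k : 'I_(2 ^ j'),
    C * 2 `^ (- a * j'%:R) <= normc (S_val (@S_partial_sum R nu alpha eps z B) (idx k)).
  by move: c0; rewrite -lt0n => /card_gt0P[k]; rewrite inE => ?; exists k.
rewrite S_partial_sumE; case: ifPn => [kB|_]; last first.
  by rewrite normc0 leNgt mulr_gt0// powR_gt0.
have j'j := idxB _ _ kB; subst j' => zC.
case: h => [|h]; first by rewrite ltNge (le_trans zC).
apply: le_trans h; rewrite ler_nat; apply: subset_leq_card.
apply/fintype.subsetP => i; rewrite inE S_partial_sumE; case: ifPn => [|_].
  by move=> /imfsetP[i' /= i'A /idx_inj ->].
by rewrite normc0 leNgt mulr_gt0// powR_gt0.
Qed.

End coef_seq_profile.

Section dual_into_S.
Context {R : realType} (nu : admissible_profile R).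
Context (alpha : nat -> R) (eps : nat -> {posnum R}).
Local Notation S := (S_top nu alpha eps).
Implicit Types u : {linear S -> R[i]^o}.

(** If level [j] had at least [2 ^ (s * j)] large coefficients, about that many entries of modulus
    [2 ^ (- (i - 2 * e) * j)], aligned with them, would give a vector of the neighbourhood where [u]
    is at least half of [2 ^ (e / 2 * j)], a contradiction for large [j]. *)
Lemma coef_seq_few u (L : seq (nat * nat)) (d e a i s : R) : 0 < d -> 0 < e ->
  (forall x : S, (forall p, p \in L -> Sclose nu alpha eps p d (S_val x)) ->
    normc (u x) < 1) ->
  (forall p, p \in L ->
    (nu (alpha p.1 + 2 * e)%R <= nu (alpha p.1) + ((eps p.2)%:num / 2)%:E)%E) ->
  (s%:E <= nu i)%E -> 0 <= s -> a - e + i <= s ->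
  exists J, forall j, (J <= j)%N ->
    (big_count (coef_seq u) (2 `^ (- (a + e / 2) * j%:R)) j)%:R < 2 `^ (s * j%:R).
Proof.
move=> d0 e0 uL nuL si s0 ais; pose C := d / 2; pose t := i - 2 * e.
have C0 : 0 < C by rewrite divr_gt0.
(* Each pair tolerates the test vector. If [alpha p.1 < t], its entries are too small to be counted;
   otherwise [i <= alpha p.1 + 2 * e], so [s <= nu (alpha p.1) + eps / 2], and the other half of
   [eps] absorbs [C]. *)
have ev1 : \forall j \near \oo, forall p, p \in L ->
    2 `^ (- t * j%:R) < C * 2 `^ (- alpha p.1 * j%:R) \/
    2 `^ (s * j%:R) <= C * pow2 (Sbound nu alpha eps p) j.
  apply: filter_seq_forall => p pL; have [pt|tp] := ltP (alpha p.1) t.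
    have pt0 : 0 < t - alpha p.1 by rewrite subr_gt0.
    have := powR2_lower C0 pt0; apply: filterS => j h; left.
    rewrite (_ : - t * j%:R = - (t - alpha p.1) * j%:R + - alpha p.1 * j%:R); last by ring.
    by rewrite powR2D ltr_pM2r// powR_gt0.
  have : (s%:E <= nu (alpha p.1) + ((eps p.2)%:num / 2)%:E)%E.
    apply: le_trans si _; apply: le_trans _ (nuL p pL).
    by apply: profile_nondecreasing; move: tp; rewrite /t; lra.
  rewrite /Sbound; case: (nu (alpha p.1)) (profile_range nu (alpha p.1)) => [r| |] [] // hr.
    2: by move/andP: hr => [_]; rewrite leye_eq.
  rewrite -EFinD lee_fin => sr.
  have e20 : 0 < (eps p.2)%:num / 2 :> R by rewrite divr_gt0.
  have := powR2_lower C0 e20; apply: filterS => j h; right.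
  rewrite /=; apply: (@le_trans _ _ (2 `^ (- ((eps p.2)%:num / 2) * j%:R) *
                                     2 `^ ((r + (eps p.2)%:num) * j%:R))).
    by rewrite -powR2D ler_powR ?ler1n// -mulrDl ler_wpM2r//; lra.
  by rewrite ler_wpM2r ?powR_ge0// ltW.
have e20 : 0 < e / 2 by rewrite divr_gt0.
have [J2 hJ2] := powR2_unbounded 2 e20.
case: ev1 => J1 _ hJ1; exists (maxn J1 J2) => j; rewrite geq_max => /andP[/hJ1 + /hJ2] /= {hJ1 hJ2}.
move=> hj ej; rewrite ltNge; apply/negP => hN.
set r := 2 `^ (s * j%:R) in hj hN.
have r1 : 1 <= r by rewrite -(powRr0 2) ler_powR ?ler1n// mulr_ge0.
(* The vector needs an integer number of entries; since [r >= 1], the integer part satisfies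
   [r <= 2 * n], and [2 ^ (e / 2 * j)] beats the factor 2. *)
pose n := Num.trunc r.
have /andP[nr rn] : n%:R <= r < n.+1%:R by rewrite trunc_itv// (le_trans ler01).
have n1 : 1 <= n%:R :> R by rewrite ler1n -ltnS -(ltr_nat R) (le_lt_trans r1).
have := le_trans nr hN; rewrite ler_nat => /subset_of_card[A AN An].
have [|x ux xA] := @aligned_test_vector R nu alpha eps u j (2 `^ (- t * j%:R)) A.
  exact: powR_ge0.
have : normc (u x) < 1.
  apply: uL => p pL; exists C; last by rewrite ltr_pdivrMr// ltr_pMr// ltr1n.
  apply: xA => //; case: (hj p pL) => [?|h]; [by left|right].
  by rewrite An (le_trans nr).
rewrite ux normc_real ltNge => /negP; apply; apply: le_trans (ler_norm _).
pose q := 2 `^ (- (a + e / 2) * j%:R).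
apply: (@le_trans _ _ (2 `^ (- t * j%:R) * (n%:R * q))); last first.
  rewrite ler_wpM2l ?powR_ge0// -An -sum1_card natr_sum mulr_suml ler_sum// => k kA.
  by rewrite mul1r; move/fintype.subsetP : AN => /(_ k kA); rewrite inE.
(* From [a - e + i <= s] and [t = i - 2 * e], the exponent [s - t - (a + e / 2)] is at least
   [e / 2]. *)
have : 2 `^ (e / 2 * j%:R) <= 2 `^ (- t * j%:R) * (r * q).
  rewrite -!powR2D ler_powR ?ler1n// -!mulrDl ler_wpM2r// /t; lra.
have tq0 : 0 < 2 `^ (- t * j%:R) * q by rewrite mulr_gt0// powR_gt0.
have : r <= 2 * n%:R by move: rn; rewrite -natr1; lra.
rewrite mulrCA [_ * (n%:R * _)]mulrCA; nra.
Qed.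

End dual_into_S.

Section dual_into_S_profile.
Context {R : realType} (nu : admissible_profile R).
Context (alpha : nat -> R) (eps : nat -> {posnum R}).
Local Notation S := (S_top nu alpha eps).
Implicit Types u : {linear S -> R[i]^o}.

Lemma big_count_le2 (x : Omega R) t j : (big_count x t j)%:R <= 2 `^ (j%:R) :> R.
Proof.
rewrite powR_mulrn// -natrX ler_nat -[leqRHS]card_ord.
exact: max_card.
Qed.

Lemma eventually_few_gt1 (x : Omega R) a c : 1 < c -> eventually_few x a c.
Proof.
move=> c1; exists 1 => //; exists 0%N => j _; apply: le_trans (big_count_le2 _ _ _) _.
by rewrite ler_powR ?ler1n// ler_peMl// ltW.
Qed.

Lemma dual_nbhs u (x : S) : topological_dual S u ->
  exists (L : seq (nat * nat)) (d : R), 0 < d /\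
    forall y : S, (forall p, p \in L -> Sclose nu alpha eps p d (S_val y - S_val x)) ->
      normc (u y - u x) < 1.
Proof.
move=> uc.
have B : nbhs (u x) (ball (u x : R[i]^o) 1) by exact: nbhsx_ballx.
have ux : nbhs x (u @^-1` ball (u x : R[i]^o) 1).
  by have h := cvg_comp _ _ (@cvg_id _ (nbhs x)) (uc x) _ B; rewrite nbhs_simpl in h.
have [L [d [d0 h]]] := @S_nbhs_basis R nu alpha eps _ _ ux.
exists L, d; split => // y /h; rewrite /= -ball_normE /= distrC => uy.
by move: uy; rewrite -ltcR.
Qed.

Lemma dual_nbhs0 u : topological_dual S u ->
  exists (L : seq (nat * nat)) (d : R), 0 < d /\
    forall x : S, (forall p, p \in L -> Sclose nu alpha eps p d (S_val x)) ->
      normc (u x) < 1.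
Proof.
move=> /dual_nbhs-/(_ 0)[L [d [d0 h]]]; exists L, d; split => // x xL.
have u0 : u 0 = 0 := linear0 u.
by have := h x; rewrite u0 !subr0; exact.
Qed.

(** One [e] suits the finitely many pairs of [L] and serves as the shift. The cases follow [clip]:
    above 1 the trivial bound [2 ^ j] suffices, otherwise [coef_seq_few] applies with [i] the
    infimum [profile_inf nu (a - e)]. *)
Lemma coef_seq_S u : alpha_min nu \is a fin_num -> topological_dual S u ->
  exists2 e : R, 0 < e & S_set (shift_profile (dual_profile nu) e) (coef_seq u).
Proof.
move=> amin /dual_nbhs0[L [d [d0 uL]]].
have : \forall e \near (0 : R)^'+, 0 < e /\ forall p, p \in L ->
    (nu (alpha p.1 + 2 * e)%R <= nu (alpha p.1) + ((eps p.2)%:num / 2)%:E)%E.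
  near=> e; split; first by near: e; exact: nbhs_right_gt.
  near: e; apply: filter_seq_forall => p _.
  by apply: profile_near_right; rewrite divr_gt0.
move=> /(@filter_ex _ _ (at_right_proper_filter _))[e [e0 nuL]]; exists e => // a.
apply/asymptotic_profile_leP => c.
rewrite /shift_profile /dual_profile -/(profile_inf nu _).
have := alpha_min_le_profile_inf nu (a - e).
case E: (profile_inf nu (a - e)) => [i| |] amini.
- rewrite -EFinD /clip lte_fin lee_fin => ec.
  move: ec; case: (ltP (a - e + i) 0) => [s0 _|s0].
    (* The dual profile is [-oo] here, so the count must vanish: with [s = 0] it is strictly less
       than [2 ^ 0 = 1]. *)
    have [J hJ] := coef_seq_few d0 e0 uL nuL (profile_inf_ge0 E) (lexx _) (ltW s0).
    exists (e / 2); first by rewrite divr_gt0.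
    exists J => j /hJ; rewrite mul0r powRr0 (ltr_nat _ _ 1) ltnS leqn0 => /eqP ->.
    exact: powR_ge0.
  case: (leP (a - e + i) 1) => [s1|s1]; rewrite lte_fin => sc; last exact: eventually_few_gt1.
  have [J hJ] := coef_seq_few d0 e0 uL nuL (profile_inf_le E) s0 (lexx _).
  exists (e / 2); first by rewrite divr_gt0.
  exists J => j /hJ /ltW /le_trans; apply.
  by rewrite ler_powR ?ler1n// ler_wpM2r// ltW.
- by rewrite /clip /= lte_fin => /eventually_few_gt1.
(* An infimum [-oo] would force [alpha_min nu = -oo]. *)
- by move: amini; rewrite leeNy_eq => /eqP amini; move: amin; rewrite amini.
Unshelve. all: by end_near.
Qed.

End dual_into_S_profile.

(** * Pairing with an element of a shifted dual space *)

Section dual_profile_theory.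
Context {R : realType} (nu : admissible_profile R).

Lemma clip_le (b : \bar R) : (clip b <= b)%E.
Proof.
rewrite /clip; case: ifPn => [_|_]; first exact: leNye.
by case: ifPn => // /negP/negP; rewrite -ltNge => /ltW.
Qed.

(** If [nu a > a + a' - e], then [a] belongs to the set whose infimum defines the dual profile at
    [a' - e], and [clip] never increases a value. *)
Lemma profile_or_dual_le (a a' e : R) :
  (nu a <= (a + a' - e)%:E)%E \/
  (shift_profile (dual_profile nu) e a' <= (a + a' - e)%:E)%E.
Proof.
have [h|h] := leP (nu a - a%:E)%E (a' - e)%:E.
  by left; move: h; rewrite leeBlDr// -EFinD [(_ - _ + _)%R]addrC addrA.
right; rewrite /shift_profile /dual_profile; apply: le_trans (clip_le _) _.
have -> : (a + a' - e)%:E = ((a' - e)%:E + a%:E)%E by rewrite -EFinD; congr EFin; ring.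
rewrite leeD2l//.
by apply: ereal_inf_lbound; exists a.
Qed.

Lemma profile_lt_alpha_min a : (a%:E < alpha_min nu)%E -> nu a = -oo%E.
Proof.
case: (profile_range nu a) => // /andP[a0 _]; rewrite ltNge => /negP[].
by apply: ereal_inf_lbound; exists a.
Qed.

(** For [nu a >= 0] and [a' = e - a - 1] the right-hand sides of [profile_or_dual_le] are [-1], so
    only its second alternative is possible. *)
Lemma dual_profile_lt0 e : exists a', (shift_profile (dual_profile nu) e a' < 0)%E.
Proof.
have [a na] := profile_nontrivial nu.
exists (e - a - 1); have [|] := profile_or_dual_le a (e - a - 1) e.
  rewrite (_ : a + _ - e = -1); last by ring.
  by case: (profile_range nu a) na => [->//|/andP[a0 _] _ /(le_trans a0)]; rewrite lee_fin ler0N1.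
rewrite (_ : a + _ - e = -1); last by ring.
by move=> /le_lt_trans; apply; rewrite lte_fin.
Qed.

Lemma S_set_count (mu : R -> \bar R) (y : Omega R) (a b c : R) :
  S_set mu y -> (mu a <= b%:E)%E -> b < c ->
  \forall j \near \oo, (big_count y (2 `^ (- a * j%:R)) j)%:R <= 2 `^ (c * j%:R) :> R.
Proof.
move=> /(_ a) /asymptotic_profile_leP h ab bc.
have [|f f0 [J hJ]] := h c; first by rewrite (le_lt_trans ab)// lte_fin.
exists J => // j /= /hJ; apply: le_trans; rewrite ler_nat; apply: big_count_le.
by rewrite ler_powR ?ler1n// ler_wpM2r// lerN2 lerDl ltW.
Qed.

Lemma S_set_bounded (mu : R -> \bar R) (y : Omega R) (a : R) :
  S_set mu y -> (mu a < 0)%E ->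
  \forall j \near \oo, forall k : 'I_(2 ^ j), normc (y (idx k)) < 2 `^ (- a * j%:R).
Proof.
move=> yS ma0; have [c c0 ac] : exists2 c, c < 0 & (mu a <= c%:E)%E.
  case: (mu a) ma0 => [r| |] // r0; first by exists r; rewrite -?lte_fin.
  by exists (-1); rewrite ?ltrN10 ?leNye.
have c20 : c < c / 2 by lra.
have c20' : 0 < - (c / 2) by lra.
have yc := S_set_count yS ac c20; have := powR2_lower (@ltr01 R) c20'.
apply: filter_app; apply: filterS yc => j yc; rewrite opprK => /(le_lt_trans yc) y1 k.
rewrite ltNge; apply/negP => yk.
by move: y1; rewrite (ltr_nat _ _ 1) ltnS leqn0 => /eqP/card0_eq/(_ k); rewrite inE yk.
Qed.

End dual_profile_theory.

(** The topology controls [x] only at the exponents [alpha n], so the grid is drawn from them: one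
    in each interval of length [h], hence consecutive ones less than [2 * h] apart. *)
Lemma dense_grid (R : realType) (alpha : nat -> R) (b h : R) :
  dense (range alpha) -> 0 < h ->
  exists n : nat -> nat, forall i, b + i%:R * h < alpha (n i) < b + i.+1%:R * h.
Proof.
move=> da h0; pose P i m := b + i%:R * h < alpha m < b + i.+1%:R * h.
suff /choice[n hn] : forall i, exists m, P i m by exists n.
move=> i.
have bi : b + i%:R * h < b + i.+1%:R * h by rewrite ltrD2l ltr_pM2r// ltr_nat.
have [||x [/= oi [m _ mx]]] := da `]b + i%:R * h, b + i.+1%:R * h[%classic.
- exists ((b + i%:R * h + (b + i.+1%:R * h)) / 2) => /=.
  by rewrite in_itv /= !midf_lt.
- exact: interval_open.
by exists m; move: oi; rewrite in_itv /P mx.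
Qed.

Lemma grid_step (R : realType) (g : nat -> R) (M : nat) (z : R) :
  z < g 0%N -> g M <= z -> exists i : 'I_M, g i.+1 <= z < g i.
Proof.
move=> z0; elim: M => [|M IH] gM; first by move: z0; rewrite ltNge gM.
have [/IH[i iz]|zM] := leP (g M) z; last by exists ord_max; rewrite /= gM.
by exists (widen_ord (leqnSn M) i).
Qed.

(** Indices with [X k < g M] or [Y k < h M] are covered by the first term. Any other [k] lies in a
    cell [g i.+1 <= X k < g i], [h i'.+1 <= Y k < h i'], and [B] bounds the contribution of each of
    the [M * M] cells. *)
Lemma sum_le_overlaps (R : realType) (T : finType) (X Y : T -> R) (g h : nat -> R)
    (M : nat) (B : R) :
  (forall k, 0 <= X k) -> (forall k, 0 <= Y k) ->
  (forall i, 0 <= g i) -> (forall i, 0 <= h i) ->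
  (forall k, X k < g 0%N) -> (forall k, Y k < h 0%N) ->
  (forall i i' : 'I_M,
    #|[set k | (g i.+1 <= X k) && (h i'.+1 <= Y k)]%SET|%:R * (g i * h i') <= B) ->
  \sum_k X k * Y k <=
    (g M * h 0%N + g 0%N * h M) * #|T|%:R + (M * M)%:R * B.
Proof.
move=> X0 Y0 g0 h0 Xg Yh EB.
pose F (i i' : 'I_M) k := (((g i.+1 <= X k) && (h i'.+1 <= Y k))%:R * (g i * h i')).
have F0 i i' k : 0 <= F i i' k by rewrite !mulr_ge0.
apply: (@le_trans _ _ (\sum_k (g M * h 0%N + g 0%N * h M + \sum_i \sum_i' F i i' k))).
  apply: ler_sum => k _.
  have S0 : 0 <= \sum_i \sum_i' F i i' k by do 2!apply: sumr_ge0 => ? _.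
  have := g0 0%N; have := g0 M; have := h0 0%N; have := h0 M; move=> hM h00 gM g00.
  have := ltW (Xg k) => Xk; have := ltW (Yh k) => Yk; have := X0 k => Xk0; have := Y0 k => Yk0.
  have [gX|Xg'] := leP (g M) (X k); last first.
    rewrite -addrA ler_wpDr ?addr_ge0 ?mulr_ge0// ler_pM// ltW//.
  have [hY|Yh'] := leP (h M) (Y k); last first.
    rewrite -addrA addrCA ler_wpDr ?addr_ge0 ?mulr_ge0// ler_pM// ltW//.
  have [i /andP[iX Xi]] := grid_step (Xg k) gX.
  have [i' /andP[iY Yi]] := grid_step (Yh k) hY.
  rewrite ler_wpDl ?addr_ge0 ?mulr_ge0//.
  rewrite (bigD1 i)//= (bigD1 i')//= -addrA ler_wpDr ?addr_ge0//.
  - by apply: sumr_ge0.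
  - by do 2!apply: sumr_ge0 => ? _.
  by rewrite /F iX iY mul1r ler_pM// ltW.
rewrite big_split /= lerD//.
  by rewrite sumr_const mulr_natr.
rewrite exchange_big /= natrM -mulrA.
have le_sum_ord (G : 'I_M -> R) (c : R) : (forall i, G i <= c) -> \sum_i G i <= M%:R * c.
  move=> Gc; apply: le_trans (ler_sum _ (fun i _ => Gc i)) _.
  by rewrite sumr_const card_ord mulr_natl.
apply: (le_sum_ord _ _) => i; rewrite exchange_big /=; apply: le_sum_ord => i'.
apply: le_trans (EB i i'); rewrite -mulr_suml ler_wpM2r ?mulr_ge0//.
rewrite -natr_sum ler_nat -sum1_card [leqRHS]big_mkcond /=.
by apply: leq_sum => k _; rewrite inE; case: ifP.
Qed.

(** * Geometric decay of the pairing along the levels *)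

Section pairing_bound.
Context {R : realType} (nu : admissible_profile R).
Context (alpha : nat -> R) (eps : nat -> {posnum R}).

Lemma Ebound_ninfty_lt (x : Omega R) (a C : R) : Ebound a -oo%E x C ->
  forall j (k : 'I_(2 ^ j)), normc (x (idx k)) < C * 2 `^ (- a * j%:R).
Proof.
move=> [_ h] j k; rewrite ltNge; apply/negP => xk.
move: (h j); rewrite /= mulr0 -(mulr0n 1) ler_nat leqn0 => /eqP/card0_eq/(_ k).
by rewrite inE xk.
Qed.

(** The overlap lies in both sets, so whichever of them is controlled bounds it; [Num.max 1 C]
    covers both outcomes. *)
Lemma overlap_count_le (x y : Omega R) (a a' b C h : R) (e : {posnum R}) j :
  0 < C -> e%:num <= h ->
  Ebound a (nu a + e%:num%:E)%E x C ->
  (nu a <= b%:E)%E \/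
    (big_count y (2 `^ (- a' * j%:R)) j)%:R <= 2 `^ ((b + h) * j%:R) ->
  #|[set k : 'I_(2 ^ j) | (C * 2 `^ (- a * j%:R) <= normc (x (idx k))) &&
       (2 `^ (- a' * j%:R) <= normc (y (idx k)))]%SET|%:R <=
    Num.max 1 C * 2 `^ ((b + h) * j%:R).
Proof.
move=> C0 eh [_ /(_ j) xC] [ab|yb].
  apply: (@le_trans _ _ (C * pow2 (nu a + e%:num%:E) j)).
    apply: le_trans xC; rewrite ler_nat; apply: subset_leq_card.
    by apply/fintype.subsetP => k; rewrite !inE => /andP[].
  apply: ler_pM; [exact: ltW|exact: pow2_ge0|by rewrite le_max lexx orbT|].
  case: (nu a) ab => [r| |] ab.
  - by rewrite /= ler_powR ?ler1n// ler_wpM2r// lerD// -lee_fin.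
  - by move: ab; rewrite leye_eq.
  - exact: powR_ge0.
apply: (@le_trans _ _ (1 * 2 `^ ((b + h) * j%:R))); last first.
  by rewrite ler_wpM2r ?powR_ge0// le_max lexx.
rewrite mul1r; apply: le_trans yb; rewrite ler_nat; apply: subset_leq_card.
by apply/fintype.subsetP => k; rewrite !inE => /andP[].
Qed.

(** Entries of [x] and [y] are sorted by size along grids of exponents [g] and [g']; in each cell
    [profile_or_dual_le] bounds the overlap through [x] or through [y]. The factor [C] comes from
    the size of the entries of [x], the factor [Num.max 1 C] from the counts. *)
Lemma pairing_level_bound (y : Omega R) (e : R) :
  alpha_min nu \is a fin_num -> dense (range alpha) ->
  (eps m)%:num @[m --> \oo] --> (0 : R) ->
  0 < e -> S_set (shift_profile (dual_profile nu) e) y ->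
  exists (L : seq (nat * nat)) (K q : R), [/\ 0 <= K, 0 < q, q < 1 &
    forall (x : Omega R) (C : R), 0 < C ->
      (forall p, p \in L -> Ebound (alpha p.1) (Sbound nu alpha eps p) x C) ->
      forall j, \sum_(k < 2 ^ j) normc (x (idx k)) * normc (y (idx k)) <=
        C * Num.max 1 C * (K * q ^+ j)].
Proof.
(* In a cell the step of [g] costs [2 * h], that of [g'] costs [h] and the count costs [h]: in all
   [e / 2] of the gain [e], which leaves a decay of exponent [e / 2]. *)
move=> amin da eps0 e0 yS; pose h := e / 8.
have h0 : 0 < h by rewrite divr_gt0.
have [m mh] : exists m, (eps m)%:num <= h.
  have : \forall m \near \oo, (eps m)%:num < h by move/cvgr_lt : eps0; exact.
  by move=> /filter_ex[m /ltW]; exists m.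
have [a0 ya0] := dual_profile_lt0 nu e.
(* The first grid point falls between [alpha_min nu - h] and [alpha_min nu], where [nu] is [-oo];
   this bounds every entry of [x] at every level. *)
pose b := fine (alpha_min nu) - h.
have [n hn] := dense_grid b da h0.
pose g i := alpha (n i); pose g' i := a0 + i%:R * h.
(* [M] makes [g M + a0] and [g 0 + g' M] at least 2, so that entries beyond the grids, even summed
   over all [2 ^ j] indices, contribute at most a multiple of [2 ^ (- j)]. *)
pose M := (Num.trunc (`|(2 - a0 - b) / h|)).+1.
have Mh : 2 - a0 - b <= M%:R * h.
  by rewrite -ler_pdivrMr// (le_trans (ler_norm _))// ltW// truncnS_gt.
have gS i : g i.+1 <= g i + 2 * h.
  have /andP[_] := hn i.+1; have /andP[+ _] := hn i; rewrite -/(g i) -/(g i.+1).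
  by rewrite -natr1 -[i.+1%:R]natr1; lra.
have gb : b < g 0%N by have /andP[] := hn 0%N; rewrite mul0r addr0.
have gM : 2 - a0 <= g M by have /andP[+ _] := hn M; rewrite -/(g M); lra.
have nug0 : nu (g 0%N) = -oo%E.
  apply: profile_lt_alpha_min; rewrite -(fineK amin) lte_fin.
  by have /andP[_] := hn 0%N; rewrite -/(g 0%N) /b; lra.
pose r i i' := g i + g' i' - e.
have ev1 : \forall j \near \oo, forall ii : 'I_M * 'I_M,
    (nu (g ii.1.+1) <= (r ii.1.+1 ii.2.+1)%:E)%E \/
    (big_count y (2 `^ (- g' ii.2.+1 * j%:R)) j)%:R <= 2 `^ ((r ii.1.+1 ii.2.+1 + h) * j%:R) :> R.
  apply: filter_forall => -[i i'] /=.
  have [?|yr] := profile_or_dual_le nu (g i.+1) (g' i'.+1) e; first by apply: nearW; left.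
  have rh : r i.+1 i'.+1 < r i.+1 i'.+1 + h by rewrite ltrDl.
  have := S_set_count yS yr rh.
  by apply: filterS; right.
have ev2 := S_set_bounded yS ya0.
have [J _ hJ] : \forall j \near \oo,
    (forall k : 'I_(2 ^ j), normc (y (idx k)) < 2 `^ (- a0 * j%:R)) /\
    forall ii : 'I_M * 'I_M,
    (nu (g ii.1.+1) <= (r ii.1.+1 ii.2.+1)%:E)%E \/
    (big_count y (2 `^ (- g' ii.2.+1 * j%:R)) j)%:R <= 2 `^ ((r ii.1.+1 ii.2.+1 + h) * j%:R) :> R.
  by apply: filterI.
pose rho := Num.min 1 (e / 2); pose q : R := 2 `^ (- rho).
have rho0 : 0 < rho by rewrite lt_min ltr01 divr_gt0.
have q0 : 0 < q by rewrite powR_gt0.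
have qj j : q ^+ j = 2 `^ (- rho * j%:R) by rewrite powRrM powR_mulrn// ltW.
have q1 : q < 1.
  have : (1 : R) `^ rho < 2 `^ rho by apply: gt0_ltr_powR; rewrite ?nnegrE// ltr1n.
  by rewrite powR1 /q powRN invf_lt1 ?powR_gt0.
(* On the finitely many levels below [J] only the bound on the entries of [x] is used; dividing by
   [q ^+ j] lets these sums enter the constant [K]. *)
pose low j : R := (\sum_(k < 2 ^ j) 2 `^ (- g 0%N * j%:R) * normc (y (idx k))) / q ^+ j.
have low0 j : 0 <= low j.
  apply: divr_ge0; last by rewrite exprn_ge0// ltW.
  by apply: sumr_ge0 => k _; rewrite mulr_ge0 ?powR_ge0 ?normc_ge0.
exists [seq (n i, m) | i <- iota 0 M.+1], ((2 + (M * M)%:R) + \sum_(j < J) low j), q.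
split=> //; first by rewrite !addr_ge0// sumr_ge0.
move=> x C C0 xL j.
have xE i : (i <= M)%N -> Ebound (g i) (nu (g i) + (eps m)%:num%:E)%E x C.
  by move=> iM; apply: (xL (n i, m)); apply: map_f; rewrite mem_iota.
have x0 : forall k : 'I_(2 ^ j), normc (x (idx k)) < C * 2 `^ (- g 0%N * j%:R).
  by apply: Ebound_ninfty_lt; have := xE 0%N isT; rewrite nug0.
have qj0 : 0 < q ^+ j by rewrite exprn_gt0.
have C1 : C <= C * Num.max 1 C by rewrite ler_peMr ?le_max ?lexx// ltW.
rewrite mulrDl mulrDr.
have [jJ|Jj] := ltnP j J.
  rewrite ler_wpDl//.
    by rewrite !mulr_ge0 ?addr_ge0 ?exprn_ge0// ?ltW// lt_max ltr01.
  apply: (@le_trans _ _ (C * (low j * q ^+ j))); last first.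
    apply: ler_pM => //; [exact: ltW|by apply: mulr_ge0 => //; exact: ltW|].
    rewrite ler_pM2r// (bigD1 (Ordinal jJ))//= lerDl sumr_ge0//.
  rewrite /low divfK ?gt_eqF// mulr_sumr; apply: ler_sum => k _.
  by rewrite mulrA ler_wpM2r ?normc_ge0// ltW.
rewrite ler_wpDr//.
  by rewrite !mulr_ge0 ?sumr_ge0 ?ltW// lt_max ltr01.
have [y0 hii] := hJ j Jj.
have EB (i i' : 'I_M) :
    #|[set k : 'I_(2 ^ j) | (C * 2 `^ (- g i.+1 * j%:R) <= normc (x (idx k))) &&
       (2 `^ (- g' i'.+1 * j%:R) <= normc (y (idx k)))]%SET|%:R *
      (C * 2 `^ (- g i * j%:R) * 2 `^ (- g' i' * j%:R)) <= C * Num.max 1 C * q ^+ j.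
  apply: le_trans (ler_wpM2r _ (overlap_count_le C0 mh (xE _ (ltn_ord i)) (hii (i, i')))) _.
    by rewrite !mulr_ge0 ?powR_ge0// ltW.
  set c := Num.max 1 C; have c0 : 0 <= c by rewrite le_max ler01.
  have eqC (s t t' : R) : c * s * (C * t * t') = C * c * (s * t * t') by ring.
  rewrite eqC -!powR2D ler_wpM2l ?mulr_ge0 ?(ltW C0)//.
  rewrite qj ler_powR ?ler1n// -!mulrDl ler_wpM2r//.
  have : rho <= e / 2 by rewrite /rho ge_min lexx orbT.
  have := gS i; rewrite /r /g' /= -[i'.+1%:R]natr1 /h; lra.
have g'0 : g' 0%N = a0 by rewrite /g' mul0r addr0.
apply: le_trans (@sum_le_overlaps R 'I_(2 ^ j) (fun k => normc (x (idx k)))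
  (fun k => normc (y (idx k))) (fun i => C * 2 `^ (- g i * j%:R))
  (fun i => 2 `^ (- g' i * j%:R)) M _ _ _ _ _ x0 _ EB) _; rewrite ?g'0//.
- by move=> k; exact: normc_ge0.
- by move=> k; exact: normc_ge0.
- by move=> i; rewrite mulr_ge0 ?powR_ge0// ltW.
have rho1 : rho <= 1 by rewrite /rho ge_min lexx.
have t1 : 2 `^ (- g M * j%:R) * 2 `^ (- a0 * j%:R) * 2 `^ j%:R <= q ^+ j.
  rewrite qj -!powR2D ler_powR ?ler1n// -[X in _ + X]mul1r -!mulrDl ler_wpM2r//; lra.
have t2 : 2 `^ (- g 0%N * j%:R) * 2 `^ (- g' M * j%:R) * 2 `^ j%:R <= q ^+ j.
  rewrite qj -!powR2D ler_powR ?ler1n// -[X in _ + X]mul1r -!mulrDl ler_wpM2r// /g'; lra.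
rewrite card_ord natrX -powR_mulrn//.
have := ler_pM (ltW C0) _ C1 t1; have := ler_pM (ltW C0) _ C1 t2.
rewrite !mulr_ge0 ?powR_ge0// => /(_ isT) + /(_ isT); lra.
Qed.

End pairing_bound.

(** * Complex series with a geometric majorant *)

Section complex_series.
Context {R : realType}.

Lemma cvg_series_geometric_dominated (u : nat -> R) (B q : R) : 0 < q -> q < 1 ->
  (forall j, `|u j| <= B * q ^+ j) -> cvgn (series u).
Proof.
move=> q0 q1 uB; apply: normed_cvg.
apply: (@series_le_cvg _ _ (geometric B q)) => //.
- by move=> j; exact: normr_ge0.
- by move=> j; exact: le_trans (normr_ge0 _) (uB j).
- by apply: is_cvg_geometric_series; rewrite gtr0_norm.
Qed.

Lemma cvg_complex (u : nat -> R[i]^o) (a b : R) :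
  complex.Re (u n) @[n --> \oo] --> a -> complex.Im (u n) @[n --> \oo] --> b ->
  u @ \oo --> (a +i* b : R[i]^o).
Proof.
move=> /cvgrPdist_lt ua /cvgrPdist_lt ub; apply/cvgrPdist_lt => e e0.
have [r r0 ->] := posC_real e0; have r20 : 0 < r / 2 by rewrite divr_gt0.
near=> n; rewrite -[ltLHS]/((normc _)%:C) ltcR.
apply: le_lt_trans (normc_le_Re_Im _) _; rewrite [ltRHS]splitr.
rewrite (_ : complex.Re _ = a - complex.Re (u n)); last by case: (u n).
rewrite (_ : complex.Im _ = b - complex.Im (u n)); last by case: (u n).
by apply: ltrD; near: n; [exact: ua|exact: ub].
Unshelve. all: by end_near.
Qed.

Lemma Re_series (f : nat -> R[i]^o) n :
  complex.Re (series f n) = series (fun j => complex.Re (f j)) n.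
Proof. by rewrite /series /=; apply: (big_morph (@complex.Re R)) => // -[? ?] [? ?]. Qed.

Lemma Im_series (f : nat -> R[i]^o) n :
  complex.Im (series f n) = series (fun j => complex.Im (f j)) n.
Proof. by rewrite /series /=; apply: (big_morph (@complex.Im R)) => // -[? ?] [? ?]. Qed.

Context (f : nat -> R[i]^o) (B q : R).
Context (q0 : 0 < q) (q1 : q < 1) (fB : forall j, normc (f j) <= B * q ^+ j).

Lemma cvg_series_complex : cvgn (series f).
Proof.
have := @cvg_complex (series f) (limn (series (fun j => complex.Re (f j))))
  (limn (series (fun j => complex.Im (f j)))).
rewrite (_ : (fun n => complex.Re _) = series (fun j => complex.Re (f j))); last first.
  by apply/funext => n; exact: Re_series.
rewrite (_ : (fun n => complex.Im _) = series (fun j => complex.Im (f j))); last first.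
  by apply/funext => n; exact: Im_series.
move=> h; apply: cvgP; apply: h.
  apply: (cvg_series_geometric_dominated q0 q1) => j.
  exact: le_trans (Re_le_normc _) (fB j).
apply: (cvg_series_geometric_dominated q0 q1) => j.
exact: le_trans (Im_le_normc _) (fB j).
Qed.

Lemma normc_lim_series_le : normc (limn (series f)) <= B / (1 - q).
Proof.
have q10 : 0 < 1 - q by rewrite subr_gt0.
have B0 : 0 <= B by have := fB 0%N; rewrite mulr1; apply: le_trans; exact: normc_ge0.
have sB n : normc (series f n) <= B / (1 - q).
  apply: (@le_trans _ _ (\sum_(0 <= j < n) B * q ^+ j)).
    rewrite /series /=; elim: n => [|n IH]; first by rewrite !big_nil normc0.
    rewrite !big_nat_recr//=; apply: le_trans (le_normcD _ _) _; exact: lerD.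
  rewrite ler_pdivlMr// -mulr_sumr -mulrA ler_piMr// big_mkord mulrC.
  by rewrite -opprB mulNr -subrX1 opprB gerBl exprn_ge0// ltW.
apply/ler_addgt0Pr => e e0.
have eC0 : (0 : R[i]) < e%:C by rewrite ltcR.
have /cvgrPdist_lt/(_ _ eC0) := cvg_series_complex.
move=> /filter_ex[n]; rewrite -[ltLHS]/((normc _)%:C) ltcR => ne.
rewrite -(subrK (series f n) (limn _)); apply: le_trans (le_normcD _ _) _.
by rewrite addrC lerD// ltW.
Qed.

End complex_series.

(** * The pairing of two sequences *)

Section pairing.
Context {R : realType}.
Implicit Types x y : Omega R.

Definition level_pairing x y (j : nat) : R[i]^o :=
  \sum_(k < 2 ^ j) x (idx k) * Num.conj (y (idx k)).

Lemma normc_level_pairing x y j :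
  normc (level_pairing x y j) <= \sum_(k < 2 ^ j) normc (x (idx k)) * normc (y (idx k)).
Proof.
rewrite /level_pairing; elim/big_rec2: _ => [|k s t _ st]; first by rewrite normc0.
by apply: le_trans (le_normcD _ _) _; rewrite normcM normc_conj lerD2l.
Qed.

Lemma level_pairing_linear (l : R[i]) x x' y j :
  level_pairing (l *: x + x') y j = l *: level_pairing x y j + level_pairing x' y j.
Proof.
rewrite /level_pairing scaler_sumr -big_split /=; apply: eq_bigr => k _.
by rewrite -[(l *: x + x') _]/(l * x (idx k) + x' (idx k)) mulrDl -mulrA.
Qed.

Lemma level_pairing_delta y l j :
  level_pairing (delta l) y j = if tag l == j then Num.conj (y l) else 0.
Proof.
rewrite /level_pairing; case: eqP => [lj|lj].
  case: l lj => i k /= ij; subst i; rewrite (bigD1 k)//= big1 => [|k' k'k].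
    by rewrite /delta eqxx mul1r addr0.
  rewrite /delta -tag_eqE /tag_eq eqxx tagged_asE /= (negbTE k'k); exact: mul0r.
apply: big1 => k _; rewrite /delta (_ : idx k == l = false) ?mul0r//.
by apply/negbTE/eqP => kl; apply: lj; rewrite -kl.
Qed.

(** Summing level by level fits the geometric bound on [level_pairing]; unconditional summability is
    recovered from continuity by [dual_has_sum]. *)
Definition pairing x y : R[i]^o := limn (series (level_pairing x y)).

Lemma pairing_linear (l : R[i]) x x' y :
  cvgn (series (level_pairing x y)) -> cvgn (series (level_pairing x' y)) ->
  pairing (l *: x + x') y = l *: pairing x y + pairing x' y.
Proof.
move=> xc x'c; rewrite /pairing -(limn_linear l xc x'c); congr (limn _).
apply/funext => n; rewrite /series /= (eq_bigr _ (fun j _ => level_pairing_linear l x x' y j)).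
by rewrite big_split /= -scaler_sumr.
Qed.

Lemma pairing_delta y l : pairing (delta l) y = Num.conj (y l).
Proof.
apply: cvg_lim; first exact: norm_hausdorff.
apply: cvg_near_cst; exists (tag l).+1 => // n /= ln; rewrite /series /=.
rewrite big_mkord (bigD1 (Ordinal ln))//= big1 => [|i il]; rewrite level_pairing_delta.
  by rewrite eqxx addr0.
by rewrite ifN//; apply: contraNneq il => li; apply/eqP/val_inj.
Qed.

End pairing.

(** * From bounds to continuity *)

Section dual_criterion.
Context {R : realType} (nu : admissible_profile R).
Context (alpha : nat -> R) (eps : nat -> {posnum R}).
Local Notation S := (S_top nu alpha eps).

Lemma S_Ebound (L : seq (nat * nat)) (x : S) : exists2 C, 0 < C &
  forall p, p \in L -> Ebound (alpha p.1) (Sbound nu alpha eps p) (S_val x) C.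
Proof.
elim: L => [|p L [C C0 IH]]; first by exists 1.
have /asboolP/ereal_inf_lt[_ [D Dx <-] _] := S_sub_E (alpha p.1) (eps p.2) (S_valP x).
exists (Num.max C D); first by rewrite lt_max C0.
move=> q; rewrite in_cons => /predU1P[->|qL].
  by apply: Ebound_up Dx _; rewrite le_max lexx orbT.
by apply: Ebound_up (IH q qL) _; rewrite le_max lexx.
Qed.

(** The distances are not norms, so boundedness takes the form of an estimate that tends to 0 with
    [C]. It gives continuity at 0, and linearity carries it to every point. *)
Lemma bounded_topological_dual (u : {linear S -> R[i]^o}) (L : seq (nat * nat)) (K : R) :
  0 <= K ->
  (forall (x : S) C, 0 < C ->
    (forall p, p \in L -> Ebound (alpha p.1) (Sbound nu alpha eps p) (S_val x) C) ->
    normc (u x) <= C * Num.max 1 C * K) ->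
  topological_dual S u.
Proof.
move=> K0 uK x; have xF := @nbhs_filter S x.
suff : u @ nbhs (x : S) --> u x by [].
apply/cvgrPdist_lt => e e0.
have [r r0 ->] := posC_real e0.
pose c := Num.min 1 (r / (K + 1)).
have c0 : 0 < c by rewrite lt_min ltr01 divr_gt0// ltr_wpDl.
have : \forall y \near x, forall p, p \in L -> Sclose nu alpha eps p c (S_val y - S_val x).
  by apply: (@filter_seq_forall _ _ _ L _ xF) => p _; exact: Sclose_nbhs.
apply: filterS => y yx.
rewrite distrC -[ltLHS]/((normc _)%:C) ltcR -raddfB.
apply: le_lt_trans (uK _ c c0 _) _ => [p /yx[C Cx /ltW Cc]|].
  exact: Ebound_up Cx Cc.
rewrite max_l ?ge_min ?lexx// mulr1.
apply: (@le_lt_trans _ _ (r / (K + 1) * K)).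
  by rewrite ler_wpM2r// /c ge_min lexx orbT.
by rewrite mulrAC ltr_pdivrMr ?ltr_wpDl// ltr_pM2l// ltrDl.
Qed.

End dual_criterion.

(** The form is the pairing with [y]: the bound on each level makes it convergent and linear on the
    whole space, and the same list [L] gives continuity. *)
Lemma S_set_dual (R : realType) (nu : admissible_profile R)
    (alpha : nat -> R) (eps : nat -> {posnum R}) (y : Omega R) (e : R) :
  alpha_min nu \is a fin_num -> dense (range alpha) ->
  (eps m)%:num @[m --> \oo] --> (0 : R) ->
  0 < e -> S_set (shift_profile (dual_profile nu) e) y ->
  exists2 u : {linear S_top nu alpha eps -> R[i]^o},
    topological_dual (S_top nu alpha eps) u & coef_seq u = y.
Proof.
move=> amin da eps0 e0 yS.
have [L [K [q [K0 q0 q1 h]]]] := pairing_level_bound amin da eps0 e0 yS.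
have bound (x : Omega R) C : 0 < C ->
    (forall p, p \in L -> Ebound (alpha p.1) (Sbound nu alpha eps p) x C) ->
    forall j, normc (level_pairing x y j) <= C * Num.max 1 C * K * q ^+ j.
  move=> C0 xC j; apply: le_trans (normc_level_pairing _ _ _) _.
  by rewrite -mulrA; exact: h.
have pc (x : S_top nu alpha eps) : cvgn (series (level_pairing (S_val x) y)).
  have [C C0 xC] := S_Ebound L x.
  exact: cvg_series_complex q0 q1 (bound _ _ C0 xC).
pose f (x : S_top nu alpha eps) : R[i]^o := pairing (S_val x) y.
have fl : linear f.
  by move=> l x x'; rewrite /f -(pairing_linear _ (pc x) (pc x')).
have [u uf] := exists_linear fl; exists u.
  apply: (@bounded_topological_dual _ _ _ _ u L (K / (1 - q))).
    by rewrite divr_ge0// subr_ge0 ltW.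
  move=> x C C0 xC; rewrite uf mulrA.
  exact: normc_lim_series_le q0 q1 (bound _ _ C0 xC).
by apply/funext => l; rewrite /coef_seq uf /f /= pairing_delta; exact: conjCK.
Qed.

Theorem theorem3 (R : realType) (nu : admissible_profile R)
    (alpha : nat -> R) (eps : nat -> {posnum R})
    (nu_alpha_min : alpha_min nu \is a fin_num)
    (alpha_dense : dense (range alpha))
    (eps_nonincr : nonincreasing_seq (fun m => (eps m)%:num))
    (eps_to0 : (eps m)%:num @[m --> \oo] --> (0 : R)) :
  set_bij (topological_dual (S_top nu alpha eps))
    (\bigcup_(e in [set e : R | 0 < e])
       S_set (shift_profile (dual_profile nu) e))
    (@coef_seq R nu alpha eps) /\
  (forall u : {linear S_top nu alpha eps -> R[i]^o},
     topological_dual (S_top nu alpha eps) u ->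
     forall x : S_top nu alpha eps,
       has_sum (fun l : Lambda => S_val x l * (coef_seq u l)^*) (u x)).
Proof.
split; last by move=> u uc x; exact: dual_has_sum.
split; last first.
- move=> y [e /= e0 yS].
  by have [u uc uy] := S_set_dual nu_alpha_min alpha_dense eps_to0 e0 yS; exists u.
- exact: coef_seq_inj.
move=> u uc; have [e e0 uS] := coef_seq_S nu_alpha_min uc.
by exists e.
Qed.
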